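(* Let $\mathcal T_d$ be the $d$-regular tree with root $o$, let $\mathcal E$ be an invariant edge percolation on $\mathcal T_d$, and let $(X_n)$ be the lazy random walk on $\mathcal T_d$ starting at $o$, independent of $\mathcal E$. Then for almost every realization of $\mathcal E$ the limit $$\lim_{n\to\infty}\mathbb P[X_{2n}\in\mathcal E(o)]^{\frac1{2n}}$$ exists, where $\mathbb P$ is the probability over the random walk with $\mathcal E$ fixed. Moreover, if $\mathcal E$ has indistinguishable clusters, then this limit is almost surely equal to $$\rho^{\mathcal E}:=\lim_{n\to\infty}\big(\mathbb E[1_{X_{2n}\in\mathcal E(o)}]\big)^{1/2n},$$ where the expectation is over both $\mathcal E$ and the random walk (in particular the latter limit exists).
   Context: An invariant edge percolation on $\mathcal T_d$ is a random subset $\mathcal E$ of the edges of $\mathcal T_d$ whose law is invariant under the automorphism group of $\mathcal T_d$. The cluster $\mathcal E(v)$ of a vertex $v$ is the connected component of $v$ in the graph with vertex set $V(\mathcal T_d)$ and edge set $\mathcal E$. The lazy random walk stays at its current vertex with probability $1/2$ and moves to each neighbor with probability $1/(2d)$. The percolation $\mathcal E$ has indistinguishable clusters if the random rooted graph $(\mathcal E(o),o)$ is ergodic, i.e. every measurable function on the space of isomorphism classes of connected rooted graphs of degree at most $d$ that does not depend on the choice of the root is almost surely constant when evaluated at $(\mathcal E(o),o)$. *)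

(* Defs.v *)
From HB Require Import structures.
From mathcomp Require Import all_boot all_order all_algebra.
From mathcomp Require Import all_classical all_reals all_analysis.

Set Implicit Arguments.
Unset Strict Implicit.
Unset Printing Implicit Defensive.

Import Order.TTheory GRing.Theory Num.Theory.
Import numFieldNormedType.Exports.

Local Open Scope classical_set_scope.
Local Open Scope ring_scope.

Section Graphs.
Variable T : Type.
Implicit Types (e : rel T) (x y : T).

Definition walk_within e (r : nat) x y :=
  exists p : seq T, [/\ path e x p, last x p = y & (size p <= r)%N].

Definition cluster e x : set T := [set y | exists r, walk_within e r x y].

Definition connected_graph e := forall x y, cluster e x y.

(* [`I_d] is the initial segment {0, ..., d-1} of nat, [#=] equipotence. *)
Definition regular_graph (d : nat) e := forall x, ([set y | e x y] #= `I_d)%card.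

Definition degree_at_most (d : nat) e := forall x, ([set y | e x y] #<= `I_d)%card.

Definition graph_automorphism e (g : T -> T) :=
  bijective g /\ forall x y, e (g x) (g y) = e x y.

End Graphs.

(* In a simple graph the duplicate-free cyclic sequences of size at most 2
   are the empty one and the two ends of an edge; the others are the genuine
   cycles. [{classic V}] is V with its classical decidable equality. *)
Definition acyclic_graph (V : Type) (e : rel V) :=
  forall c : seq {classic V}, @ucycle {classic V} e c -> (size c <= 2)%N.

Definition regular_tree (d : nat) (V : Type) (e : rel V) :=
  [/\ symmetric e, irreflexive e, connected_graph e, acyclic_graph e
    & regular_graph d e].

(** Rooted graphs and the local topology *)

(* Every connected graph of bounded degree is countable, so vertex types in
   Set miss no isomorphism class; with vertex : Type, the type of all rooted
   graphs would be too large for sets of its elements and the clusters of an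
   arbitrary V to be both available. *)
Record rooted_graph := RootedGraph {
  vertex : Set;
  edge : rel vertex;
  root : vertex }.

Definition rooted_iso (G H : rooted_graph) :=
  exists f : vertex G -> vertex H,
    [/\ bijective f, forall x y, edge (f x) (f y) = edge x y
      & f (root G) = root H].

Definition reroot (G : rooted_graph) (v : vertex G) : rooted_graph :=
  RootedGraph (@edge G) v.

Lemma walk_within_refl (T : Type) (e : rel T) r x : walk_within e r x x.
Proof. by exists [::]. Qed.

Lemma cluster_refl (T : Type) (e : rel T) x : cluster e x x.
Proof. by exists 0%N; exact: walk_within_refl. Qed.

(* The subgraph induced on the ball of radius r around the root. *)
Definition root_ball (r : nat) (G : rooted_graph) : rooted_graph :=
  @RootedGraph {x : vertex G | walk_within (@edge G) r (root G) x}
    (fun x y => edge (sval x) (sval y))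
    (exist _ (root G) (walk_within_refl _ r _)).

Definition cluster_graph (V : Set) (e : rel V) (v : V) : rooted_graph :=
  @RootedGraph {x : V | cluster e v x}
    (fun x y => e (sval x) (sval y))
    (exist _ v (cluster_refl e v)).

Definition connected_rooted_graphs (d : nat) : set rooted_graph :=
  [set G | [/\ symmetric (@edge G), irreflexive (@edge G),
               connected_graph (@edge G) & degree_at_most d (@edge G)]].

(* The basic open sets of the local topology; up to isomorphism there are
   countably many nonempty ones, so they generate its Borel sets. *)
Definition local_cylinder (d : nat) : set (set rooted_graph) :=
  [set A | exists r H,
     A = connected_rooted_graphs d `&` [set G | rooted_iso (root_ball r G) H]].

(* A measurable real function on the space of isomorphism classes, seen as a
   function of representatives. *)
Definition measurable_graph_function (R : realType) (d : nat)
    (F : rooted_graph -> R) :=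
  (forall G H, connected_rooted_graphs d G -> connected_rooted_graphs d H ->
     rooted_iso G H -> F G = F H) /\
  (forall B : set R, measurable B ->
     <<s connected_rooted_graphs d, local_cylinder d >>
       (connected_rooted_graphs d `&` F @^-1` B)).

Definition root_independent (R : realType) (d : nat) (F : rooted_graph -> R) :=
  forall G, connected_rooted_graphs d G ->
    forall v : vertex G, F (reroot v) = F G.

(** Invariant percolation; a set of edges is given as a symmetric subrelation
    of the adjacency relation *)

Definition edge_cylinder (V : Type) : set (set (rel V)) :=
  [set A | exists x y : V, A = [set eta : rel V | eta x y]].

(* The preimage of the edge set eta under g; this is the image under g^-1. *)
Definition pull_edges (V : Type) (g : V -> V) (eta : rel V) : rel V :=
  fun x y => eta (g x) (g y).

Definition invariant_percolation d0 (Omega : measurableType d0) (R : realType)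
    (P : probability Omega R) (V : Type) (adj : rel V) (E : Omega -> rel V) :=
  [/\ forall w, symmetric (E w) /\ subrel (E w) adj,
      forall B, <<s @edge_cylinder V >> B -> measurable (E @^-1` B)
    & forall g, graph_automorphism adj g ->
      forall B, <<s @edge_cylinder V >> B ->
        P [set w | B (pull_edges g (E w))] = P [set w | B (E w)] ].

Definition indistinguishable_clusters d0 (Omega : measurableType d0)
    (R : realType) (P : probability Omega R) (d : nat) (V : Set) (o : V)
    (E : Omega -> rel V) :=
  forall F : rooted_graph -> R,
    measurable_graph_function d F -> root_independent d F ->
    exists c : R, {ae P, forall w, F (cluster_graph (E w) o) = c}.

(** Lazy random walk *)

Definition lazy_step (R : realType) (d : nat) (V : Type) (adj : rel V)
    (x y : V) : R :=
  if `[< x = y >] then 2%:R^-1 else if adj x y then (2 * d)%N%:R^-1 else 0.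

Definition lazy_random_walk d1 (Omega : measurableType d1) (R : realType)
    (Q : probability Omega R) (d : nat) (V : Type) (adj : rel V) (o : V)
    (X : nat -> Omega -> V) :=
  (forall n v, measurable [set w | X n w = v]) /\
  (forall (n : nat) (x : nat -> V),
     Q [set w | forall i, (i <= n)%N -> X i w = x i] =
     (`[< x 0%N = o >]%:R * \prod_(i < n) lazy_step R d adj (x i) (x i.+1))%:E).

(** Return probabilities to the cluster of o; E and the walk X live on the two
    factors of a product space, hence are independent *)

Definition quenched_return d0 d1 (Omega : measurableType d0)
    (Omega' : measurableType d1) (R : realType) (Q : probability Omega' R)
    (V : Type) (o : V) (E : Omega -> rel V) (X : nat -> Omega' -> V)
    (n : nat) (w : Omega) : R :=
  fine (Q [set w' | cluster (E w) o (X n w')]).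

Definition annealed_return d0 d1 (Omega : measurableType d0)
    (Omega' : measurableType d1) (R : realType) (P : probability Omega R)
    (Q : probability Omega' R) (V : Type) (o : V) (E : Omega -> rel V)
    (X : nat -> Omega' -> V) (n : nat) : R :=
  fine ('E_(P \x Q)
    [\1_[set z : Omega * Omega' | cluster (E z.1) o (X n z.2)]])%E.

(* Main.v *)
Require Import Defs.
From HB Require Import structures.
From mathcomp Require Import all_boot all_order all_algebra.
From mathcomp Require Import all_classical all_reals all_analysis.
From mathcomp Require Import measurable_realfun perm lra zify.

(** Let a n be the probability, given the percolation, that the lazy walk is at
    time n in the cluster of its starting point, and let l n = - ln (a n) / n.
    The theorem says that l converges almost surely along even times, and
    identifies the limit when it is constant; the odd times come for free.

    The tree is a Cayley graph of the free product of d copies of Z/2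
    ([tree_coding_exists]), so its right translations give the mass transport
    principle ([mass_transport]).  In operator form: let Q_n be the n-step
    kernel of the walk restricted to pairs of vertices of the same cluster.
    It is self-adjoint for the scalar product of functions of the percolation
    seen from a vertex ([cluster_avg_selfadjoint]), and Q_n Q_m <= Q_(n+m)
    ([cluster_avg_comp]), while a n = Q_n 1.

    Convergence.  If a n is large at o, the mass of Q_n at o may go to vertices
    where a n is small, but by self-adjointness that is unlikely: the expected
    mass sent to a set of vertices is the expectation of a n on that set.
    Iterating, the expectation of a n on the event Q_n^j 1 <= t^j is at most
    j t ([return_small_iter_avg]).  Since Q_n^j 1 <= a (j n), up to an event of
    probability polynomial in j and n times s, a (j n) > (s a n)^j
    ([bad_scale_bound]).  With s a negative power of n, Borel-Cantelli gives
    l (j n) <= l n + O(ln n / n) for all large n and all j <= n^3 at once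
    ([ae_decay_rate_multiples]).  Laziness gives a (n+1) >= a n / 2, which
    interpolates between multiples, and an elementary argument concludes
    ([cvg_of_multiples]).

    The annealed limit.  Suppose that l tends almost surely to a constant L.
    Truncating 1 to the event that a (2^k n) is not too large gives a function
    f with <f, Q_n f>^(2^k) <= <f, Q_n^(2^k) f>, by Cauchy-Schwarz, hence
    E (a n) <= exp (- n L) ([annealed_rate_ge]); Jensen's inequality gives
    E (a n) >= exp (- n E (l n)) ([annealed_rate_le]) and E (l n) tends to L.

    Constancy.  In a tree, the distance inside a cluster is the distance of the
    ambient tree, so a n is a function of the rooted cluster.  The property
    that a n <= C r^n for some C and all n extends to all rooted graphs as a
    measurable property that does not depend on the root ([slow_return]), and
    for r = exp (- q) it compares the limit of l to q.  Indistinguishability,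
    used for all rational q, makes the limit constant ([ae_constant_rate]). *)

Set Implicit Arguments.
Unset Strict Implicit.
Unset Printing Implicit Defensive.

Import Order.TTheory GRing.Theory Num.Theory.
Import numFieldNormedType.Exports.

Local Open Scope classical_set_scope.
Local Open Scope ring_scope.

Local Notation cluster := Defs.cluster.

(** * Convergence from comparisons along multiples *)

Section SquaringChain.
Variable R : realType.
Implicit Types (l phi : nat -> R).

Lemma iter_square_ge (n k : nat) : (0 < n)%N ->
  (n <= iter k (fun m => m * m) n)%N.
Proof.
move=> n0; elim: k => //= k IH; apply: leq_trans (IH) _.
by rewrite leq_pmulr// (leq_trans n0).
Qed.

Lemma iter_square_bracket (n m : nat) : (1 < n)%N -> (n * n <= m)%N ->
  exists k, let q := iter k (fun m => m * m)%N n in (q * q <= m < (q * q) * (q * q))%N.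
Proof.
move=> n1 nm; pose sq k := iter k (fun m => m * m)%N n.
have sqk k : (k < sq k)%N.
  elim: k => [|k IH]; first exact: ltnW.
  rewrite [sq _]/= -/(sq k); apply: leq_ltn_trans IH _.
  rewrite -[X in (X < _)%N]muln1 ltn_pmul2l; last exact: leq_trans (ltnW n1) (iter_square_ge _ (ltnW n1)).
  exact: leq_trans n1 (iter_square_ge _ (ltnW n1)).
have [k km] : exists k, (m < sq k.+1)%N by exists m; exact: ltn_trans (sqk m.+1).
elim: k km => [|k IH] km; first by exists 0%N; rewrite /= nm; move: km => /=; lia.
have [/IH//|qm] := ltnP m (sq k.+1).
by exists k; apply/andP.
Qed.

(** Comparing two arbitrary times only costs two things here: passing from n to
    j n loses phi n, and rounding a time down to a multiple of n loses B / n.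
    Squaring n repeatedly makes the losses phi summable, and between n ^ 2 and
    n ^ 4 every time is nearly a multiple of n. *)
Lemma cvg_of_multiples l phi (B : R) :
  (forall n, 0 <= l n <= B) -> (forall n, 0 <= phi n) -> phi @ \oo --> 0 ->
  (forall n, (4 <= n)%N -> 2 * phi (n * n)%N <= phi n) ->
  (\forall n \near \oo, forall j, (0 < j <= n ^ 3)%N -> l (j * n)%N <= l n + phi n) ->
  (forall k m, (k <= m)%N -> m%:R * l m <= k%:R * l k + (m - k)%:R * B) ->
  cvgn l.
Proof.
move=> l0B phi0 phicvg phisq [N1 _ multN] slow.
have l0 n : 0 <= l n by case/andP: (l0B n).
have lB n : l n <= B by case/andP: (l0B n).
have B0 : 0 <= B := le_trans (l0 0%N) (lB 0%N).
(* The supremum of S is the limit inferior of l. *)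
pose S := [set x | exists N, forall m, (N <= m)%N -> x <= l m].
have S0 : S 0 by exists 0%N.
have hS : has_sup S.
  split; first by exists 0.
  by exists B => x [N /(_ N (leqnn _)) xl]; apply: le_trans (lB N).
apply/cvg_ex; exists (sup S); apply/cvgrPdist_le => e e0.
have e4 : 0 < e / 4 by rewrite divr_gt0.
have [x [N2 N2x] xS] := sup_adherent e0 hS.
have [N3 _ N3phi] : \forall n \near \oo, phi n <= e / 4.
  move/cvgrPdist_le : phicvg => /(_ _ e4); apply: filterS => n.
  by rewrite sub0r normrN ger0_norm.
pose N4 := (Num.bound (B / (e / 4))).+1.
have BN4 n : (N4 <= n)%N -> B / n%:R <= e / 4.
  move=> N4n; have n0 : 0 < n%:R :> R by rewrite ltr0n (leq_trans _ N4n).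
  rewrite ler_pdivrMr// mulrC -ler_pdivrMr//.
  apply: le_trans (ltW (archi_boundP _)) _; first by rewrite divr_ge0// ltW.
  by rewrite ler_nat ltnW.
pose N := maxn (maxn N1 N3) (maxn N4 4).
(* A time n with a rate close to the limit inferior, past all thresholds. *)
have [n Nn ln] : exists2 n, (N <= n)%N & l n < sup S + e / 4.
  apply: contrapT => H; have : S (sup S + e / 4).
    exists N => m Nm; rewrite leNgt; apply/negP => lm; apply: H; exists m => //.
  by move/(sup_upper_bound hS); rewrite gerDl leNgt e4.
have [N1n N3n N4n n4] : [/\ N1 <= n, N3 <= n, N4 <= n & 4 <= n]%N.
  by move: Nn; rewrite /N !geq_max => /andP[/andP[-> ->] /andP[-> ->]].
have n0 : (0 < n)%N by exact: leq_trans n4.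
pose sq k := iter k (fun m => m * m)%N n.
have sqn k : (n <= sq k)%N by exact: iter_square_ge.
have chain k : l (sq k) + 2 * phi (sq k) <= l n + 2 * phi n.
  elim: k => // k IH; apply: le_trans IH; rewrite [sq k.+1]/= -/(sq k).
  have q4 := leq_trans n4 (sqn k).
  have h1 := phisq _ q4.
  have h2 : l (sq k * sq k)%N <= l (sq k) + phi (sq k).
    apply: multN => /=; first exact: leq_trans (sqn k).
    by rewrite (leq_trans _ q4)//= -{1}(expn1 (sq k)) leq_exp2l// (leq_trans _ q4).
  lra.
exists (maxn (n * n) N2) => // m; rewrite /= geq_max => /andP[nm N2m].
have lowm : sup S - e <= l m by apply: le_trans (N2x m N2m); exact: ltW.
have [k /= /andP[qm mq]] := iter_square_bracket (leq_trans (isT : (1 < 4)%N) n4) nm.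
rewrite -/(sq k) in qm mq; set q := sq k in qm mq.
have q4 : (4 <= q)%N := leq_trans n4 (sqn k).
have q0 : (0 < q)%N by exact: leq_trans q4.
have m0 : (0 < m)%N by apply: leq_trans qm; rewrite muln_gt0 q0.
have jlow : (q <= m %/ q)%N by rewrite leq_divRL.
have jup : (m %/ q <= q ^ 3)%N.
  rewrite -ltnS ltn_divLR//; apply: leq_trans mq _.
  by rewrite !expnS expn0 muln1 mulSn; nia.
have lj : l (m %/ q * q)%N <= l q + phi q.
  by apply: multN => /=; [exact: leq_trans (sqn k)|rewrite (leq_trans q0 jlow)].
have lm : l m <= l q + phi q + B / q%:R.
  have mR : 0 < m%:R :> R by rewrite ltr0n.
  have qR : 0 < q%:R :> R by rewrite ltr0n.
  have sm := slow _ _ (leq_trunc_div m q).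
  have h1 : (m %/ q * q)%:R * l (m %/ q * q)%N <= m%:R * l (m %/ q * q)%N.
    by rewrite ler_wpM2r// ler_nat leq_trunc_div.
  have h2 : (m - m %/ q * q)%:R * B <= m%:R * (B / q%:R).
    rewrite mulrCA mulrC ler_wpM2l// ler_pdivlMr// -natrM ler_nat.
    apply: leq_trans qm; rewrite leq_mul2r; apply/orP; right.
    rewrite {1}(divn_eq m q) addKn ltnW// ltn_pmod//.
  rewrite -(ler_pM2l mR) mulrDr.
  apply: le_trans sm _; apply: lerD => //.
  by apply: le_trans h1 _; rewrite ler_pM2l.
have phn := N3phi n N3n.
have phq := phi0 q.
have Bq : B / q%:R <= e / 4 by apply: BN4; exact: leq_trans (sqn k).
have := chain k; rewrite -/q => ck.
rewrite ler_norml; apply/andP; split; rewrite -/q in ck *; last lra.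
have : phi n <= e / 4 := phn; lra.
Qed.

End SquaringChain.

(** * The regular tree as a Cayley graph *)

Section Words.
Variable d : nat.
Implicit Types (i j : 'I_d) (w : seq 'I_d).

Definition reduced w := sorted (fun i j => i != j) w.

(** Left multiplication by the i-th generator of the free product of d copies of
    Z/2, whose elements are the reduced words. *)
Definition letter i w :=
  if w is j :: w' then if i == j then w' else i :: w else [:: i].

Lemma letter_cons i w : reduced (i :: w) -> letter i w = i :: w.
Proof. by case: w => [//|j w] /= /andP[/negbTE ->]. Qed.

Lemma reduced_letter i w : reduced w -> reduced (letter i w).
Proof.
case: w => [//|j w] rw /=; case: eqVneq => [_|ij]; first exact: path_sorted rw.
by apply/andP; split.
Qed.

Lemma letterK i w : reduced w -> letter i (letter i w) = w.
Proof.
case: w => [_|j w rw] /=; first by rewrite eqxx.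
case: eqVneq => [->|ij]; first by rewrite letter_cons.
by rewrite /= eqxx.
Qed.

Definition word_mul w x := foldr letter x w.

Lemma reduced_word_mul w x : reduced x -> reduced (word_mul w x).
Proof. by move=> rx; elim: w => //= i w IH; exact: reduced_letter. Qed.

Lemma word_mul_letter i w x : reduced w -> reduced x ->
  word_mul (letter i w) x = letter i (word_mul w x).
Proof.
case: w => [//|j w] rw rx /=; case: eqVneq => [->|//].
by rewrite letterK//; exact: reduced_word_mul.
Qed.

Lemma size_letter_le i w : (size (letter i w) <= (size w).+1)%N.
Proof. by case: w => [//|j w] /=; case: ifP => // _; lia. Qed.

Lemma letter_inj w : injective (fun i => letter i w).
Proof.
case: w => [|k w] i j /=; first by case.
case: eqVneq => [->|ki]; case: eqVneq => [->|kj] //; last by case.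
  by move/(congr1 size) => /=; lia.
by move/(congr1 size) => /=; lia.
Qed.

Lemma word_ball_finite n : exists L : seq (seq 'I_d),
  forall w, (size w <= n)%N -> w \in L.
Proof.
exists (flatten [seq [seq val t | t : k.-tuple 'I_d] | k <- iota 0 n.+1]) => w wn.
apply/flatten_mapP; exists (size w).
  by rewrite mem_iota add0n.
by apply/mapP; exists (in_tuple w) => //; rewrite mem_enum.
Qed.

End Words.

Section TreeColoring.
Variables (d : nat) (V : Type) (adj : rel V) (o : V).
Hypothesis treeV : regular_tree d adj.
Implicit Types (i j : 'I_d) (u v x y : V) (w : seq 'I_d).

Let adj_sym : symmetric adj. Proof. by case: treeV. Qed.
Let adj_irr : irreflexive adj. Proof. by case: treeV. Qed.

(** A colouring of the edges at v by the letters. *)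
Definition frame v (b : 'I_d -> V) :=
  injective b /\ forall u, adj v u <-> exists i, b i = u.

Lemma frame_exists v : exists b, frame v b.
Proof.
case: treeV => _ _ _ _ /(_ v)/card_esym/card_bijP[f fbij].
have fI (i : 'I_d) : (i : nat) \in `I_d by rewrite inE/=.
pose b i := val (f (SigSub (fI i))).
exists b; split=> [i j /val_inj/(bij_inj fbij)/(congr1 val)/= /ord_inj//|u].
split=> [vu|[i <-]]; last by have := valP (f (SigSub (fI i))); rewrite inE.
case: fbij => g gK fK.
have uN : u \in [set y | adj v y] by rewrite inE.
have gI : (val (g (SigSub uN)) < d)%N.
  by have := valP (g (SigSub uN)); rewrite inE.
exists (Ordinal gI); rewrite /b.
have -> : SigSub (fI (Ordinal gI)) = g (SigSub uN) by apply: val_inj.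
by rewrite fK.
Qed.

Lemma frame_exists_at v i u : adj v u -> exists b, frame v b /\ b i = u.
Proof.
move=> vu; have [b [binj bN]] := frame_exists v.
have [j bj] := (bN u).1 vu.
exists (b \o tperm i j); split; last by rewrite /= tpermL.
split=> [|x]; first exact: inj_comp binj (@perm_inj _ _).
rewrite bN; split=> [[k <-]|[k <-]]; last by eexists.
by exists (tperm i j k); rewrite /= tpermK.
Qed.

Let first_frame : {b | frame o b}. Proof. exact/cid/frame_exists. Qed.

Let next_frame v i u : {b | adj v u -> frame v b /\ b i = u}.
Proof.
apply: cid; case: (boolP (adj v u)) => [/(frame_exists_at i)[b ?]|_].
  by exists b.
by exists (fun=> o).
Qed.

(** The vertex reached from o by following the letters of w from right to left,
    together with a frame at that vertex in which the last letter read leads back.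
    This makes reading the same letter twice a return, as in the free product. *)
Fixpoint walk_state w : V * ('I_d -> V) :=
  if w is i :: w' then
    let: (v, b) := walk_state w' in (b i, sval (next_frame (b i) i v))
  else (o, sval first_frame).

Definition word_vertex w := (walk_state w).1.

Lemma word_vertex_cons i w : word_vertex (i :: w) = (walk_state w).2 i.
Proof. by rewrite /word_vertex /=; case: (walk_state w). Qed.

Lemma walk_state_frame w : frame (word_vertex w) (walk_state w).2.
Proof.
elim: w => [|i w IH]; first exact: (svalP first_frame).
rewrite /word_vertex /=; move: IH; rewrite /word_vertex.
case: (walk_state w) => v b /= [binj bN].
case: next_frame => b' /= -[]//; rewrite adj_sym; apply/bN.
by exists i.
Qed.

Lemma walk_state_back i w : (walk_state (i :: w)).2 i = word_vertex w.
Proof.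
rewrite /word_vertex /=; have := walk_state_frame w; rewrite /word_vertex.
case: (walk_state w) => v b /= [binj bN].
case: next_frame => b' /= -[]//; rewrite adj_sym; apply/bN.
by exists i.
Qed.

Lemma walk_state_letter i w : reduced w ->
  (walk_state w).2 i = word_vertex (letter i w).
Proof.
case: w => [_|j w rw]; first by rewrite -word_vertex_cons.
rewrite /letter; case: eqVneq => [->|ij]; first exact: walk_state_back.
by rewrite -word_vertex_cons.
Qed.

Lemma adj_word_vertex w u : reduced w ->
  adj (word_vertex w) u <-> exists i, word_vertex (letter i w) = u.
Proof.
move=> rw; rewrite (walk_state_frame w).2.
by split=> -[i <-]; exists i; rewrite walk_state_letter.
Qed.

Lemma word_vertex_letter_inj w : reduced w ->
  injective (fun i => word_vertex (letter i w)).
Proof.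
move=> rw i j; rewrite -!walk_state_letter//; exact: (walk_state_frame w).1.
Qed.

Lemma word_vertex_surj v : exists2 w, reduced w & word_vertex w = v.
Proof.
have [_ _ /(_ o v)[r [p [op <- _]]] _ _] := treeV.
elim/last_ind: p op => [_|p x IH]; first by exists [::].
rewrite rcons_path last_rcons => /andP[/IH[w rw <-]].
move/(adj_word_vertex _ rw) => [i <-]; exists (letter i w) => //.
exact: reduced_letter.
Qed.

Fixpoint word_trace w : seq {classic V} :=
  if w is i :: w' then word_vertex w :: word_trace w' else [:: o].

Lemma word_trace_path w : path adj (word_vertex w) (behead (word_trace w)).
Proof.
elim: w => [//|i w IH] /=.
suff -> : word_trace w = word_vertex w :: behead (word_trace w).
  rewrite /= IH andbT adj_sym; apply/(walk_state_frame w).2.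
  by exists i; rewrite word_vertex_cons.
by case: (w).
Qed.

(** A reduced word does not backtrack, so a repetition at shortest distance along
    its walk would close a cycle with at least three vertices. *)
Lemma word_trace_uniq w : reduced w -> uniq (word_trace w).
Proof.
elim: w => [//|i w IH] rw; rewrite [word_trace _]/=.
have {}IH := IH (path_sorted rw).
rewrite cons_uniq IH andbT; apply/negP => xw.
have eqw : word_trace w = word_vertex w :: behead (word_trace w).
  by case: (w).
have vx : adj (word_vertex (i :: w)) (word_vertex w).
  rewrite adj_sym; apply/(walk_state_frame w).2.
  by exists i; rewrite word_vertex_cons.
have := word_trace_path w; move: IH; rewrite eqw in xw *; move: xw.
rewrite inE => /orP[/eqP e|].
  by move: vx; rewrite e adj_irr.
set q := behead _ => xq.
have [_ _ _ acyc _] := treeV.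
have [p1 [p2 eq]] : exists p1 p2, q = rcons p1 (word_vertex (i :: w)) ++ p2.
  by case/path.splitP: xq => p1 p2; exists p1, p2.
rewrite eq -cat_cons cat_uniq => /andP[u1 _]; rewrite cat_path => /andP[pth _].
have /acyc : @ucycle {classic V} adj (word_vertex w :: rcons p1 (word_vertex (i :: w))).
  by rewrite /ucycle u1 andbT /= rcons_path pth last_rcons.
rewrite /= size_rcons; case: p1 eq {u1 pth xq} => [eq _|? ? _]; last by rewrite !ltnS ltn0.
case: w rw @q eq {eqw vx} => [//|j w] /= /andP[ij _].
have eqw : word_trace w = word_vertex w :: behead (word_trace w).
  by case: (w).
rewrite eqw /= => -[+ _]; rewrite word_vertex_cons -(walk_state_back j).
by move/(walk_state_frame (j :: w)).1 => e; rewrite e eqxx in ij.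
Qed.

(** By induction on w': the vertex of its tail is a neighbour of the vertex of w,
    so by induction that tail is w with one letter multiplied.
    Acyclicity enters in the base case, through [word_trace_uniq]. *)
Lemma word_vertex_inj w w' : reduced w -> reduced w' ->
  word_vertex w = word_vertex w' -> w = w'.
Proof.
elim: w' w => [|j w' IH] w rw rw' e.
  case: w rw e => [//|i w] /word_trace_uniq /=.
  have ow : (o : {classic V}) \in word_trace w.
    elim: w => [|k w]; first by rewrite inE.
    by move=> IH; rewrite /= inE IH orbT.
  by move=> /andP[+ _] e; rewrite e {1}/word_vertex /= ow.
have rw'' := path_sorted rw'.
have : adj (word_vertex w) (word_vertex w').
  rewrite e adj_sym; apply/(walk_state_frame w').2.
  by exists j; rewrite word_vertex_cons.
move/(adj_word_vertex _ rw) => [k /(IH _ (reduced_letter _ rw) rw'') ek].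
have ew : w = letter k w' by rewrite -ek letterK.
rewrite -(letter_cons rw') ew; congr letter.
by apply: (word_vertex_letter_inj rw''); rewrite -ew e letter_cons.
Qed.

End TreeColoring.

(** A bijection between the vertices and the reduced words that turns adjacency
    into left multiplication by a generator, that is, an identification of the
    tree with a Cayley graph. *)
Record tree_coding (d : nat) (V : Type) (adj : rel V) (o : V) := TreeCoding {
  word_of : V -> seq 'I_d;
  vertex_of : seq 'I_d -> V;
  word_ofK : cancel word_of vertex_of;
  reduced_word_of : forall x, reduced (word_of x);
  vertex_ofK : forall w, reduced w -> word_of (vertex_of w) = w;
  adj_word_of : forall x y,
    adj x y <-> exists i, word_of y = letter i (word_of x);
  word_of_root : word_of o = [::]
}.

Lemma tree_coding_exists (d : nat) (V : Type) (adj : rel V) (o : V) :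
  regular_tree d adj -> $|tree_coding d adj o|.
Proof.
move=> treeV.
have /choice[crd crdP] : forall v, exists w, reduced w /\ word_vertex o treeV w = v.
  by move=> v; have [w] := word_vertex_surj o treeV v; exists w.
have crdV w : reduced w -> crd (word_vertex o treeV w) = w.
  move=> rw; have [r e] := crdP (word_vertex o treeV w).
  exact: word_vertex_inj r rw e.
apply/squash; apply: (@TreeCoding d V adj o crd (word_vertex o treeV)) => //.
- by move=> x; case: (crdP x).
- by move=> x; case: (crdP x).
- move=> x y; have [rx {1}<-] := crdP x; rewrite adj_word_vertex//.
  split=> -[i e]; exists i; first by rewrite -e crdV//; exact: reduced_letter.
  by rewrite -e; case: (crdP y).
- by rewrite -[RHS]crdV.
Qed.

Section Coding.
Variables (d : nat) (V : Type) (adj : rel V) (o : V).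
Variable c : tree_coding d adj o.
Implicit Types (i j : 'I_d) (x y : V).

Local Notation crd := (word_of c).

Lemma word_of_inj : injective crd.
Proof. exact: can_inj (word_ofK c). Qed.

Definition act i x := vertex_of c (letter i (crd x)).

Lemma word_of_act i x : crd (act i x) = letter i (crd x).
Proof. by rewrite vertex_ofK//; exact/reduced_letter/reduced_word_of. Qed.

Lemma actK i : involutive (act i).
Proof.
by move=> x; apply: word_of_inj; rewrite !word_of_act letterK//; exact: reduced_word_of.
Qed.

Lemma act_inj x : injective (fun i => act i x).
Proof.
by move=> i j e; apply: (@letter_inj _ (crd x)); rewrite -!word_of_act e.
Qed.

Lemma adj_act x y : adj x y <-> exists i, act i x = y.
Proof.
rewrite (adj_word_of c); split=> -[i e]; exists i; last by rewrite -e word_of_act.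
by apply: word_of_inj; rewrite word_of_act.
Qed.

Lemma act_ind (S : V -> Prop) :
  S o -> (forall i x, S x -> S (act i x)) -> forall x, S x.
Proof.
move=> So Sact x; rewrite -(word_ofK c x); have := reduced_word_of c x.
elim: (crd x) => [_|i w IH rw].
  by suff -> : vertex_of c [::] = o by []; rewrite -(word_of_root c) word_ofK.
suff -> : vertex_of c (i :: w) = act i (vertex_of c w).
  exact/Sact/IH/(path_sorted rw).
apply: word_of_inj; rewrite word_of_act !vertex_ofK ?letter_cons//.
exact: path_sorted rw.
Qed.

(** The automorphisms that commute with the left multiplications, that is, the
    right translations of the group. *)
Definition translation g := graph_automorphism adj g /\
  forall i x, g (act i x) = act i (g x).

Lemma translation_root_inj g h : (forall i x, g (act i x) = act i (g x)) ->
  (forall i x, h (act i x) = act i (h x)) -> g o = h o -> g =1 h.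
Proof. by move=> gA hA e x; elim/act_ind: x => // i x IH; rewrite gA hA IH. Qed.

(** Right multiplication by a generator. Being an involution, it exchanges o and
    its i-th neighbour, which is what unimodularity needs. *)
Definition shift i x := vertex_of c (word_mul (crd x) [:: i]).

Lemma word_of_shift i x : crd (shift i x) = word_mul (crd x) [:: i].
Proof. by rewrite vertex_ofK//; exact: reduced_word_mul. Qed.

Lemma shift_root i : shift i o = act i o.
Proof. by apply: word_of_inj; rewrite word_of_shift word_of_act word_of_root. Qed.

Lemma shift_act i j x : shift i (act j x) = act j (shift i x).
Proof.
apply: word_of_inj; rewrite word_of_act !word_of_shift word_of_act.
by rewrite word_mul_letter//; exact: reduced_word_of.
Qed.

Lemma shiftK i : involutive (shift i).
Proof.
apply: translation_root_inj => // [j x|]; first by rewrite !shift_act.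
by rewrite shift_root shift_act shift_root actK.
Qed.

Lemma translation_shift i : translation (shift i).
Proof.
split=> [|j x]; last exact: shift_act.
split=> [|x y]; first by exists (shift i); exact: shiftK.
apply/idP/idP => /adj_act[j e]; apply/adj_act; exists j.
  by apply: (inv_inj (shiftK i)); rewrite shift_act.
by rewrite -e shift_act.
Qed.

Lemma coding_countable : countable [set: V].
Proof.
apply/countable_injP; exists (pickle \o crd) => x y _ _.
by move/(pcan_inj pickleK)/word_of_inj.
Qed.

End Coding.

(** * The averaging operator of the lazy random walk *)

Section Averaging.
Variables (R : realType) (d : nat) (V : Type) (adj : rel V) (o : V).
Variable c : tree_coding d adj o.
Hypothesis d_gt0 : (0 < d)%N.
Implicit Types (i j : 'I_d) (x y : V) (f g : V -> R).

Local Notation act := (act c).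

Definition lazy_avg f x : R :=
  2^-1 * f x + (2 * d)%:R^-1 * \sum_(i < d) f (act i x).

Definition walk_avg n f := iter n lazy_avg f.

Lemma lazy_avgD f g x :
  lazy_avg (fun y => f y + g y) x = lazy_avg f x + lazy_avg g x.
Proof. by rewrite /lazy_avg big_split/= !mulrDr addrACA. Qed.

Lemma lazy_avgZ (a : R) f x : lazy_avg (fun y => a * f y) x = a * lazy_avg f x.
Proof. by rewrite /lazy_avg -mulr_sumr mulrDr !(mulrCA _ a). Qed.

Lemma lazy_avg1 x : lazy_avg (fun=> 1) x = 1.
Proof.
rewrite /lazy_avg big_const_ord iter_addr_0 natrM.
have : d%:R != 0 :> R by rewrite pnatr_eq0 -lt0n.
by move: (d%:R) => D D0; rewrite invfM -mulrA mulVf// mulr1; lra.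
Qed.

Lemma le_lazy_avg f g x : (forall y, f y <= g y) -> lazy_avg f x <= lazy_avg g x.
Proof.
move=> fg; rewrite /lazy_avg lerD// ler_wpM2l ?invr_ge0//.
by apply: ler_sum => i _.
Qed.

Lemma walk_avgS n f x : walk_avg n.+1 f x = lazy_avg (walk_avg n f) x.
Proof. by []. Qed.

Lemma walk_avgSr n f x : walk_avg n.+1 f x = walk_avg n (lazy_avg f) x.
Proof. by rewrite /walk_avg iterSr. Qed.

Lemma walk_avgD n f g x :
  walk_avg n (fun y => f y + g y) x = walk_avg n f x + walk_avg n g x.
Proof.
elim: n x => [//|n IH] x; rewrite !walk_avgS -lazy_avgD.
by congr lazy_avg; apply/funext => y; exact: IH.
Qed.

Lemma walk_avgZ n (a : R) f x :
  walk_avg n (fun y => a * f y) x = a * walk_avg n f x.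
Proof.
elim: n x => [//|n IH] x; rewrite !walk_avgS -lazy_avgZ.
by congr lazy_avg; apply/funext => y; exact: IH.
Qed.

Lemma walk_avg1 n x : walk_avg n (fun=> 1) x = 1.
Proof.
elim: n x => [//|n IH] x; rewrite walk_avgS -[RHS](lazy_avg1 x).
by congr lazy_avg; apply/funext => y; exact: IH.
Qed.

Lemma walk_avg0 n x : walk_avg n (fun=> 0) x = 0.
Proof.
rewrite -[RHS](mul0r (walk_avg n (fun=> 1) x)) -walk_avgZ; congr walk_avg.
by apply/funext => y; rewrite mul0r.
Qed.

Lemma walk_avg_sum n (I : Type) (s : seq I) (F : I -> V -> R) x :
  walk_avg n (fun y => \sum_(k <- s) F k y) x = \sum_(k <- s) walk_avg n (F k) x.
Proof.
elim: s => [|k s IH].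
  rewrite big_nil -[RHS](walk_avg0 n x); congr walk_avg.
  by apply/funext => y; rewrite big_nil.
rewrite big_cons -IH -walk_avgD; congr walk_avg.
by apply/funext => y; rewrite big_cons.
Qed.

Lemma le_walk_avg n f g x :
  (forall y, f y <= g y) -> walk_avg n f x <= walk_avg n g x.
Proof.
by move=> fg; elim: n x => [//|n IH] x; rewrite !walk_avgS le_lazy_avg.
Qed.

Lemma walk_avg_ge0 n f x : (forall y, 0 <= f y) -> 0 <= walk_avg n f x.
Proof. by move=> /(le_walk_avg n x); rewrite walk_avg0. Qed.

Lemma walk_avg_le1 n f x : (forall y, f y <= 1) -> walk_avg n f x <= 1.
Proof. by move=> /(le_walk_avg n x); rewrite walk_avg1. Qed.

Lemma walk_avg_add n m f x : walk_avg (n + m) f x = walk_avg n (walk_avg m f) x.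
Proof. by rewrite /walk_avg iterD. Qed.

Lemma half_le_walk_avg n f x : (forall y, 0 <= f y) ->
  2^-1 * walk_avg n f x <= walk_avg n.+1 f x.
Proof.
move=> f0; rewrite walk_avgS /lazy_avg lerDl mulr_ge0 ?invr_ge0//.
by apply: sumr_ge0 => i _; exact: walk_avg_ge0.
Qed.

Lemma walk_avg_translation n f (g : V -> V) x :
  (forall i x, g (act i x) = act i (g x)) ->
  walk_avg n (f \o g) x = walk_avg n f (g x).
Proof.
move=> gA; elim: n x => [//|n IH] x; rewrite !walk_avgS /lazy_avg IH.
by under eq_bigr => i _ do rewrite IH gA.
Qed.

Definition dirac_fun x : V -> R := fun y => `[< x = y >]%:R.

(** Reversibility of the walk: each generator acts as an involution. *)
Lemma walk_avg_dirac_sym n x y :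
  walk_avg n (dirac_fun y) x = walk_avg n (dirac_fun x) y.
Proof.
elim: n x y => [|n IH] x y.
  by rewrite /= /dirac_fun (_ : (y = x) = (x = y))//; apply/propext; split.
rewrite walk_avgS walk_avgSr /lazy_avg IH.
under eq_bigr => i _ do rewrite IH.
rewrite -walk_avg_sum -!walk_avgZ -walk_avgD; congr walk_avg.
apply/funext => z; congr (_ * _ + _ * _); apply: eq_bigr => i _.
rewrite /dirac_fun (_ : (act i x = z) = (x = act i z))//.
by apply/propext; split=> [<-|->]; rewrite actK.
Qed.

Lemma eq_walk_avg_ball n f g x :
  (forall y, (size (word_of c y) <= size (word_of c x) + n)%N -> f y = g y) ->
  walk_avg n f x = walk_avg n g x.
Proof.
elim: n x => [|n IH] x fg; first by apply: fg; rewrite addn0.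
rewrite !walk_avgS /lazy_avg; congr (_ * _ + _ * _).
  by apply: IH => y yn; apply: fg; rewrite addnS ltnW.
apply: eq_bigr => i _; apply: IH => y yn; apply: fg.
apply: leq_trans yn _; rewrite addnS -addSn leq_add2r word_of_act.
exact: size_letter_le.
Qed.

End Averaging.

(** * The law of the lazy random walk *)

Section Law.
Variables (R : realType) (d : nat) (V : Type) (adj : rel V) (o : V).
Variable c : tree_coding d adj o.
Hypotheses (d_gt0 : (0 < d)%N) (adj_irr : irreflexive adj).
Variables (d1 : measure_display) (Omega' : measurableType d1).
Variables (Q : probability Omega' R) (X : nat -> Omega' -> V).
Hypothesis walkX : lazy_random_walk Q d adj o X.

Lemma measure_bigsetU_seq (d0 : measure_display) (T : measurableType d0)
    (mu : {measure set T -> \bar R}) (I : choiceType) (s : seq I) (F : I -> set T) :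
  uniq s -> (forall i, measurable (F i)) ->
  (forall i j w, F i w -> F j w -> i = j) ->
  mu (\big[setU/set0]_(i <- s) F i) = (\sum_(i <- s) mu (F i))%E.
Proof.
move=> + mF tF; elim: s => [|i s IH]; first by rewrite !big_nil measure0.
move=> /= /andP[si us]; have mU : measurable (\big[setU/set0]_(j <- s) F j).
  exact: bigsetU_measurable.
rewrite !big_cons measureU//; first by rewrite -(IH us).
apply/seteqP; split=> // w [Fi]; rewrite -bigcup_seq => -[j /= js Fj].
by move: si; rewrite (tF _ _ _ Fi Fj) js.
Qed.

Let path_event k (x : nat -> V) := [set w | forall i, (i <= k)%N -> X i w = x i].

Lemma measurable_walk_set n (S : set V) : measurable [set w | S (X n w)].
Proof.
have -> : [set w | S (X n w)] =
    \bigcup_v (if `[< S v >] then [set w | X n w = v] else set0).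
  apply/seteqP; split=> [w Sw|w [v _]]; last first.
    by case: asboolP => // Sv; rewrite /= => ->.
  by exists (X n w) => //; case: asboolP.
apply: countable_bigcupT_measurable; first exact: coding_countable c.
by move=> v; case: asboolP => // _; exact: walkX.1.
Qed.

Let measurable_path_event k x : measurable (path_event k x).
Proof.
have -> : path_event k x = \bigcap_(i in [set i | (i <= k)%N]) [set w | X i w = x i].
  by apply/seteqP; split.
by apply: bigcap_measurable => [|i _]; [exists 0%N|exact: walkX.1].
Qed.

Let option_letters : seq (option 'I_d) := None :: map Some (enum 'I_d).

Let option_act (a : option 'I_d) x := if a is Some i then act c i x else x.

Let option_weight (a : option 'I_d) : R := if a is Some i then (2 * d)%:R^-1 else 2^-1.

Let adj_act_self i x : adj x (act c i x).
Proof. by apply/(adj_act c); exists i. Qed.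

Let lazy_step_weight a x : lazy_step R d adj x (option_act a x) = option_weight a.
Proof.
rewrite /lazy_step; case: a => [i|] /=; last by case: asboolP.
case: asboolP => [e|_]; last by rewrite adj_act_self.
by have := adj_act_self i x; rewrite -e adj_irr.
Qed.

Let option_act_inj x : injective (fun a => option_act a x).
Proof.
move=> [i|] [j|] //= e.
- by rewrite (act_inj e).
- by have := adj_act_self i x; rewrite e adj_irr.
- by have := adj_act_self j x; rewrite -e adj_irr.
Qed.

Let sum_option_letters (G : option 'I_d -> \bar R) :
  (\sum_(a <- option_letters) G a = G None + \sum_(i < d) G (Some i))%E.
Proof. by rewrite big_cons big_map big_enum. Qed.

Let option_letters_uniq : uniq option_letters.
Proof.
rewrite /= map_inj_uniq ?enum_uniq ?andbT; last by move=> ? ? [].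
by apply/mapP => -[].
Qed.

Let extend k (x : nat -> V) y n := if (n <= k)%N then x n else y.

Let path_event_extend k x y :
  path_event k.+1 (extend k x y) = path_event k x `&` [set w | X k.+1 w = y].
Proof.
apply/seteqP; split=> w.
  move=> H; split=> [i ik|]; last by have /= := H k.+1 (leqnn _); rewrite /extend ltnn.
  by have := H i (leq_trans ik (leqnSn _)); rewrite /extend ik.
move=> [Hx Hy] i; rewrite leq_eqVlt => /predU1P[->|ik].
  by rewrite /extend ltnn.
by rewrite Hx// /extend (_ : (i <= k)%N).
Qed.

Let measure_path_event_extend k x a :
  Q (path_event k.+1 (extend k x (option_act a (x k)))) =
  (Q (path_event k x) * (option_weight a)%:E)%E.
Proof.
rewrite /path_event !walkX.2 -EFinM -mulrA; congr (_%:E); congr (_ * _).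
rewrite big_ord_recr /= /extend leqnn ltnn lazy_step_weight.
by congr (_ * _); apply: eq_bigr => i _; rewrite (ltn_ord i) (ltnW (ltn_ord i)).
Qed.

(** The d + 1 one-step continuations of a path have the full probability of the
    path, so all other outcomes are negligible. *)
Let markov_property m k x (S : set V) :
  Q (path_event k x `&` [set w | S (X (k + m)%N w)]) =
  (Q (path_event k x) * (walk_avg c m (fun y => `[< S y >]%:R) (x k))%:E)%E.
Proof.
elim: m k x => [|m IH] k x.
  rewrite addn0 /=; case: asboolP => Sx /=.
    rewrite mule1; congr (Q _); apply/seteqP; split=> w; first by case.
    by move=> H; split=> //=; rewrite H.
  rewrite mule0 -[RHS](measure0 Q); congr (Q _); apply/seteqP; split=> // w [H].
  by rewrite /= H.
set A := [set w | _].
have mA : measurable A by exact: measurable_walk_set.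
pose F a := path_event k.+1 (extend k x (option_act a (x k))).
have FE a : F a = path_event k x `&` [set w | X k.+1 w = option_act a (x k)].
  exact: path_event_extend.
have QF a : Q (F a) = (Q (path_event k x) * (option_weight a)%:E)%E.
  exact: measure_path_event_extend.
have mF a : measurable (F a) by exact: measurable_path_event.
have tF a b w : F a w -> F b w -> a = b.
  by rewrite !FE => -[_ /= ->] [_ /=]; exact: option_act_inj.
pose B := \big[setU/set0]_(a <- option_letters) F a.
have mB : measurable B by exact: bigsetU_measurable.
have QB : Q B = Q (path_event k x).
  have -> : Q B = (\sum_(a <- option_letters) Q (F a))%E.
    by rewrite /B measure_bigsetU_seq.
  rewrite sum_option_letters.
  rewrite QF.
  under eq_bigr => i _ do rewrite QF.
  have Qfin : Q (path_event k x) \is a fin_num by exact: fin_num_measure.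
  rewrite -(fineK Qfin) /=.
  under eq_bigr => i _ do rewrite -EFinM.
  rewrite -EFinM sumEFin -EFinD -mulr_sumr -mulrDr -[in RHS](mulr1 (fine _)).
  congr (_ * _)%:E; rewrite -[RHS](lazy_avg1 R c d_gt0 o) /lazy_avg mulr1 mulr_sumr.
  by congr (_ + _); apply: eq_bigr => i _; rewrite mulr1.
have BS : B `<=` path_event k x.
  rewrite /B -bigcup_seq => w [a _]; rewrite FE; by case.
have null : Q (path_event k x `\` B) = 0%E.
  have e : Q (path_event k x) = (Q (path_event k x `\` B) + Q B)%E.
    have := measureDI Q (measurable_path_event k x) mB.
    by rewrite (_ : path_event k x `&` B = B)//; apply/setIidPr.
  rewrite QB in e.
  have Qfin : Q (path_event k x) \is a fin_num by exact: fin_num_measure.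
  by have := congr1 (fun t => (t - Q (path_event k x))%E) e; rewrite addeK// subee.
have -> : Q (path_event k x `&` A) = Q (\big[setU/set0]_(a <- option_letters) (F a `&` A)).
  have -> : \big[setU/set0]_(a <- option_letters) (F a `&` A) = B `&` A.
    by rewrite /B -!bigcup_seq setI_bigcupl.
  have mD : measurable (path_event k x `&` A `\` B).
    by apply: measurableD => //; exact: measurableI.
  rewrite -(@measureU0 _ _ _ Q (B `&` A) _ _ mD); last 2 first.
  - exact: measurableI.
  - apply: (subset_measure0 (B := path_event k x `\` B)) => //.
      exact: measurableD.
    by move=> w [[]].
  congr (Q _); apply/seteqP; split=> w.
    by move=> [pw Aw]; have [Bw|nBw] := pselect (B w); [left|right].
  by move=> [[/BS]|[[]]].
have -> : Q (\big[setU/set0]_(a <- option_letters) (F a `&` A)) =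
    (\sum_(a <- option_letters) Q (F a `&` A))%E.
  rewrite measure_bigsetU_seq//; last by move=> a b w [+ _] [+ _]; exact: tF.
  by move=> a; exact: measurableI.
have eqF a : Q (F a `&` A) = (Q (path_event k x) *
   (option_weight a * walk_avg c m (fun y => `[< S y >]%:R) (option_act a (x k)))%:E)%E.
  by rewrite /A addnS -addSn IH QF /extend ltnn EFinM muleA.
rewrite sum_option_letters eqF.
under eq_bigr => i _ do rewrite eqF.
have Qfin : Q (path_event k x) \is a fin_num by exact: fin_num_measure.
rewrite -(fineK Qfin) /=.
under eq_bigr => i _ do rewrite -EFinM.
rewrite -!EFinM sumEFin -EFinD -mulr_sumr -mulrDr; congr (_ * _)%:E.
by rewrite [RHS]/lazy_avg mulr_sumr.
Qed.

Lemma walk_law n (S : set V) :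
  Q [set w | S (X n w)] = (walk_avg c n (fun y => `[< S y >]%:R) o)%:E.
Proof.
have Q1 : Q (path_event 0 (fun=> o)) = 1%E.
  by rewrite /path_event walkX.2 big_ord0 mulr1; case: asboolP.
have := markov_property n 0 (fun=> o) S; rewrite Q1 mul1e add0n => <-.
have mA := measurable_walk_set n S; have mp := measurable_path_event 0 (fun=> o).
have Q0 : Q (~` path_event 0 (fun=> o)) = 0%E.
  by rewrite probability_setC// Q1 subee.
rewrite (measureDI Q mA mp) [X in (X + _)%E](_ : _ = 0%E) ?add0e 1?setIC//.
apply: (subset_measure0 _ _ _ Q0); last by move=> w [].
- exact: measurableD.
- exact: measurableC.
Qed.

End Law.

(** * Expectations of functions of the configuration *)

(** The type of edge sets with the sigma-algebra of the percolation. *)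
Definition config (V : Type) := g_sigma_algebraType (@edge_cylinder V).

HB.instance Definition _ (V : Type) := Measurable.on (config V).

Section Expectation.
Variables (R : realType) (V : Type) (adj : rel V).
Variables (d0 : measure_display) (Omega : measurableType d0).
Variables (P : probability Omega R) (E : Omega -> rel V).
Hypothesis invE : invariant_percolation P adj E.
Implicit Types (F G : config V -> R) (A : set (config V)).

(** Boundedness makes every expectation below finite. *)
Definition bmeas F :=
  measurable_fun setT F /\ exists M, forall eta, `|F eta| <= M.

Lemma bmeas_cst a : bmeas (fun=> a).
Proof. by split=> //; exists `|a|. Qed.

Lemma bmeasD F G : bmeas F -> bmeas G -> bmeas (fun eta => F eta + G eta).
Proof.
move=> [mF [M FM]] [mG [N GN]]; split; first exact: measurable_funD.
by exists (M + N) => eta; rewrite (le_trans (ler_normD _ _))// lerD.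
Qed.

Lemma bmeasM F G : bmeas F -> bmeas G -> bmeas (fun eta => F eta * G eta).
Proof.
move=> [mF [M FM]] [mG [N GN]]; split; first exact: measurable_funM.
by exists (M * N) => eta; rewrite normrM ler_pM.
Qed.

Lemma bmeasZ a F : bmeas F -> bmeas (fun eta => a * F eta).
Proof. exact/bmeasM/bmeas_cst. Qed.

Lemma bmeasB F G : bmeas F -> bmeas G -> bmeas (fun eta => F eta - G eta).
Proof.
move=> bF bG; rewrite (_ : (fun _ => _) = fun eta => F eta + -1 * G eta).
  exact/bmeasD/bmeasZ.
by apply/funext => eta; rewrite mulN1r.
Qed.

Lemma bmeasX F n : bmeas F -> bmeas (fun eta => F eta ^+ n).
Proof.
move=> bF; elim: n => [|n IH]; first exact: bmeas_cst.
rewrite (_ : (fun _ => _) = fun eta => F eta * F eta ^+ n); first exact: bmeasM.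
by apply/funext => eta; rewrite exprS.
Qed.

Lemma bmeas_sum I (s : seq I) (F : I -> config V -> R) :
  (forall i, bmeas (F i)) -> bmeas (fun eta => \sum_(i <- s) F i eta).
Proof.
move=> bF; elim: s => [|i s IH].
  rewrite (_ : (fun _ => _) = fun=> 0); first exact: bmeas_cst.
  by apply/funext => eta; rewrite big_nil.
rewrite (_ : (fun _ => _) = fun eta => F i eta + \sum_(i <- s) F i eta).
  exact: bmeasD.
by apply/funext => eta; rewrite big_cons.
Qed.

Lemma bmeas_event A : measurable A -> bmeas (fun eta => `[< A eta >]%:R).
Proof.
move=> mA; split; last by exists 1 => eta; case: asboolP; rewrite ?normr1 ?normr0.
exact: (@measurable_indic _ _ R setT A).
Qed.

Lemma measurable_config_map : measurable_fun setT (E : Omega -> config V).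
Proof. by move=> _ B mB; rewrite setTI; case: invE => _ + _; apply. Qed.

Lemma bmeas_measurable F : bmeas F -> measurable_fun setT (fun w => F (E w)).
Proof.
move=> [mF _]; exact: measurableT_comp mF measurable_config_map.
Qed.

Lemma bmeas_integrable F : bmeas F -> P.-integrable setT (EFin \o (fun w => F (E w))).
Proof.
move=> bF; apply: measurable_bounded_integrable => //.
- by rewrite (le_lt_trans (probability_le1 P _))// ltry.
- exact: bmeas_measurable.
- have [_ [M FM]] := bF; exists M; split; first exact: num_real.
  by move=> x Mx w _; apply: le_trans (FM _) _; exact: ltW.
Qed.

Definition expect F : R := Rintegral P setT (fun w => F (E w)).

Lemma expect_cst a : expect (fun=> a) = a.
Proof.
rewrite /expect Rintegral_cst// -[RHS]mulr1; congr (_ * _).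
by rewrite -[RHS]/(fine 1%E); congr fine; exact: probability_setT.
Qed.

Lemma expectD F G : bmeas F -> bmeas G ->
  expect (fun eta => F eta + G eta) = expect F + expect G.
Proof. by move=> bF bG; rewrite /expect RintegralD//; exact: bmeas_integrable. Qed.

Lemma expectZ a F : bmeas F -> expect (fun eta => a * F eta) = a * expect F.
Proof. by move=> bF; rewrite /expect RintegralZl//; exact: bmeas_integrable. Qed.

Lemma expectB F G : bmeas F -> bmeas G ->
  expect (fun eta => F eta - G eta) = expect F - expect G.
Proof. by move=> bF bG; rewrite /expect RintegralB//; exact: bmeas_integrable. Qed.

Lemma expect_sum I (s : seq I) (F : I -> config V -> R) :
  (forall i, bmeas (F i)) ->
  expect (fun eta => \sum_(i <- s) F i eta) = \sum_(i <- s) expect (F i).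
Proof.
move=> bF; elim: s => [|i s IH].
  rewrite big_nil -[RHS](expect_cst 0); congr expect.
  by apply/funext => eta; rewrite big_nil.
rewrite big_cons -IH -expectD//; last exact: bmeas_sum.
by congr expect; apply/funext => eta; rewrite big_cons.
Qed.

Lemma le_expect F G : bmeas F -> bmeas G -> (forall eta, F eta <= G eta) ->
  expect F <= expect G.
Proof.
move=> bF bG FG; rewrite /expect le_Rintegral//; exact: bmeas_integrable.
Qed.

Lemma expect_ge0 F : (forall eta, 0 <= F eta) -> 0 <= expect F.
Proof. by move=> F0; apply: Rintegral_ge0. Qed.

(** The variance is nonnegative. *)
Lemma expect_sqr_le F : bmeas F -> expect F ^+ 2 <= expect (fun eta => F eta ^+ 2).
Proof.
move=> bF; set m := expect F.
have : 0 <= expect (fun eta => (F eta - m) ^+ 2).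
  by apply: expect_ge0 => eta; exact: sqr_ge0.
rewrite (_ : (fun _ => _) = fun eta => (F eta ^+ 2 - (2 * m) * F eta) + m ^+ 2); last first.
  by apply/funext => eta; rewrite !expr2; lra.
have bF2 := bmeasX 2 bF; have bZ := bmeasZ (2 * m) bF.
rewrite (expectD (bmeasB bF2 bZ) (bmeas_cst (m ^+ 2))) (expectB bF2 bZ).
rewrite (expectZ _ bF) expect_cst.
by rewrite -/m !expr2; lra.
Qed.

Lemma expect_event A : measurable A ->
  (expect (fun eta => `[< A eta >]%:R))%:E = P [set w | A (E w)].
Proof.
move=> mA; rewrite /expect /Rintegral fineK; last first.
  by apply: integrable_fin_num => //; exact: (bmeas_integrable (bmeas_event mA)).
have mEA : measurable [set w | A (E w)].
  by have := measurable_config_map measurableT mA; rewrite setTI.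
by rewrite -[X in _ = P X]setIT -integral_indic.
Qed.

Lemma measurable_pull_edges (g : V -> V) :
  measurable_fun setT (pull_edges g : config V -> config V).
Proof.
apply: (@measurability _ _ (config V) (config V) _ _ (@edge_cylinder V)) => //.
move=> _ [_ [x [y ->]] <-]; rewrite setTI.
by apply: sub_sigma_algebra; exists (g x), (g y).
Qed.

Lemma bmeas_pull_edges F g : bmeas F -> bmeas (fun eta => F (pull_edges g eta)).
Proof.
move=> [mF [M FM]]; split; last by exists M.
exact: measurableT_comp mF (measurable_pull_edges g).
Qed.

Lemma expect_pull_edges F g : graph_automorphism adj g -> bmeas F ->
  expect (fun eta => F (pull_edges g eta)) = expect F.
Proof.
move=> gA bF; rewrite /expect /Rintegral; congr fine.
have mE := measurable_config_map.
have mg : measurable_fun setT (fun w => pull_edges g (E w) : config V).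
  exact: measurableT_comp (measurable_pull_edges g) mE.
have mF : measurable_fun setT (EFin \o F) by apply/measurable_EFinP; case: bF.
have i1 := bmeas_integrable (bmeas_pull_edges g bF).
have i2 := bmeas_integrable bF.
have e1 := integral_pushforward mE mF i2 measurableT.
have e2 := integral_pushforward mg mF i1 measurableT.
etransitivity; first exact: (esym e2).
etransitivity; last exact: e1.
apply: eq_measure_integral => B mB _.
by case: invE => _ _ /(_ g gA B mB).
Qed.

End Expectation.

(** * Clusters and mass transport *)

Section Clusters.
Variables (V : Type).
Implicit Types (eta : rel V) (x y z : V) (g : V -> V).

Lemma clusterP eta x y :
  cluster eta x y <-> exists p, path eta x p /\ last x p = y.
Proof.
split=> [[r [p [? ? _]]]|[p [? ?]]]; first by exists p.
by exists (size p), p.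
Qed.

Lemma cluster_trans eta x y z :
  cluster eta x y -> cluster eta y z -> cluster eta x z.
Proof.
move=> /clusterP[p [pp pl]] /clusterP[q [qp ql]]; apply/clusterP; exists (p ++ q).
by rewrite cat_path last_cat pp pl.
Qed.

Lemma cluster_sym eta x y : symmetric eta -> cluster eta x y -> cluster eta y x.
Proof.
move=> eta_sym /clusterP[p [+ <-]]; elim/last_ind: p => [_|p z IH].
  exact: cluster_refl.
rewrite rcons_path last_rcons => /andP[/IH c e]; apply: cluster_trans c.
by apply/clusterP; exists [:: last x p]; rewrite /= eta_sym e.
Qed.

Lemma cluster_pull_edges eta g x y : bijective g ->
  cluster (pull_edges g eta) x y <-> cluster eta (g x) (g y).
Proof.
move=> [h gK hK]; split=> /clusterP[p [pp pl]]; apply/clusterP.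
  by exists (map g p); rewrite last_map pl path_map.
exists (map h p); split; last by rewrite -{1}(gK x) last_map pl gK.
by rewrite -[X in path _ _ X](mapK hK) path_map in pp.
Qed.

(** Symmetrised, so that it is an equivalence relation for every configuration,
    not only for the symmetric ones. *)
Definition conn eta x y := `[< cluster eta x y /\ cluster eta y x >].

Lemma conn_refl eta x : conn eta x x.
Proof. by apply/asboolP; split; exact: cluster_refl. Qed.

Lemma conn_sym eta x y : conn eta x y = conn eta y x.
Proof. by apply: asbool_equiv_eq; split=> -[]. Qed.

Lemma conn_trans eta x y z : conn eta x y -> conn eta y z -> conn eta x z.
Proof.
move=> /asboolP[xy yx] /asboolP[yz zy]; apply/asboolP; split.
  exact: cluster_trans xy yz.
exact: cluster_trans zy yx.
Qed.

Lemma conn_eq eta x y z : conn eta x y -> conn eta x z = conn eta y z.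
Proof.
move=> xy; apply/idP/idP; last exact: conn_trans xy.
by apply: conn_trans; rewrite conn_sym.
Qed.

Lemma conn_symmetric eta x y : symmetric eta -> conn eta x y <-> cluster eta x y.
Proof.
move=> eta_sym; split=> [/asboolP[]//|xy]; apply/asboolP; split=> //.
exact: cluster_sym.
Qed.

Lemma conn_pull_edges eta g x y : bijective g ->
  conn (pull_edges g eta) x y = conn eta (g x) (g y).
Proof.
move=> gbij; apply: asbool_equiv_eq.
by rewrite !(propext (cluster_pull_edges _ _ _ gbij)).
Qed.

Lemma measurable_cluster x y : countable [set: V] ->
  measurable [set eta : config V | cluster eta x y].
Proof.
move=> /countable_injP[code codeI].
have mpath p : measurable [set eta : config V | path (eta : rel V) x p].
  elim: p x => [|z p IH] x.
    by rewrite (_ : [set _ | _] = setT)//; apply/seteqP.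
  rewrite (_ : [set _ | _] = [set eta : config V | (eta : rel V) x z] `&`
      [set eta : config V | path (eta : rel V) z p]).
    apply: measurableI => //.
    by apply: sub_sigma_algebra; exists x, z.
  by apply/seteqP; split=> eta /= => [/andP[]|[-> ->]].
rewrite (_ : [set _ | _] = \bigcup_p
   (if `[< last x p = y >] then [set eta : config V | path (eta : rel V) x p] else set0)).
  apply: countable_bigcupT_measurable; last by move=> p; case: ifP.
  apply/countable_injP; exists (pickle \o map code) => p q _ _.
  move=> /(pcan_inj pickleK); apply: inj_map => u v uv.
  by apply: codeI; rewrite ?inE.
apply/seteqP; split=> eta; first by case/clusterP => p [pp pl]; exists p => //; case: asboolP.
by case=> p _; case: asboolP => // pl pp; apply/clusterP; exists p.
Qed.

Lemma measurable_conn x y : countable [set: V] ->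
  measurable [set eta : config V | conn eta x y].
Proof.
move=> cV; rewrite (_ : [set _ | _] = [set eta : config V | cluster eta x y] `&`
  [set eta : config V | cluster eta y x]).
  by apply: measurableI; exact: measurable_cluster.
by apply/seteqP; split=> eta /asboolP.
Qed.

End Clusters.

Section MassTransport.
Variables (R : realType) (d : nat) (V : Type) (adj : rel V) (o : V).
Variable c : tree_coding d adj o.
Hypothesis d_gt0 : (0 < d)%N.
Variables (d0 : measure_display) (Omega : measurableType d0).
Variables (P : probability Omega R) (E : Omega -> rel V).
Hypothesis invE : invariant_percolation P adj E.
Implicit Types (eta : config V) (x y z : V).

Local Notation expect := (expect P E).

Lemma bmeas_lazy_avg (F : config V -> V -> R) x :
  (forall y, bmeas (fun eta => F eta y)) -> bmeas (fun eta => lazy_avg c (F eta) x).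
Proof.
move=> bF; apply: bmeasD; first exact: bmeasZ.
exact/bmeasZ/bmeas_sum.
Qed.

Lemma bmeas_walk_avg n (F : config V -> V -> R) x :
  (forall y, bmeas (fun eta => F eta y)) -> bmeas (fun eta => walk_avg c n (F eta) x).
Proof. by move=> bF; elim: n x => [|n IH] x; [exact: bF|exact: bmeas_lazy_avg]. Qed.

(** By induction on the number of steps. The last step of the walk is moved from
    the second argument of the kernel to the first by the translation exchanging
    o and its i-th neighbour, under which the law of the percolation is invariant. *)
Lemma mass_transport n (K : config V -> V -> V -> R) :
  (forall x y, bmeas (fun eta => K eta x y)) ->
  (forall g, translation c g -> forall eta x y,
     K (pull_edges g eta) x y = K eta (g x) (g y)) ->
  expect (fun eta => walk_avg c n (K eta o) o) =
  expect (fun eta => walk_avg c n (fun y => K eta y o) o).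
Proof.
elim: n K => [//|n IH] K bK invK.
transitivity (expect (fun eta => walk_avg c n (fun y => lazy_avg c (K eta y) o) o)).
  under eq_fun => eta do rewrite walk_avgSr.
  apply: (IH (fun eta x => lazy_avg c (K eta x))) => [x y|g gT eta x y].
    exact: bmeas_lazy_avg.
  rewrite /lazy_avg invK//; congr (_ * _ + _ * _).
  by apply: eq_bigr => i _; rewrite invK// gT.2.
have bG z x : bmeas (fun eta => walk_avg c n (fun y => K eta y z) x).
  exact: bmeas_walk_avg.
transitivity (2^-1 * expect (fun eta => walk_avg c n (fun y => K eta y o) o) +
  (2 * d)%:R^-1 * \sum_(i < d) expect (fun eta => walk_avg c n (fun y => K eta y (act c i o)) o)).
  rewrite -(expect_sum invE)// -!(expectZ invE)//; last exact: bmeas_sum.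
  rewrite -(expectD invE)//; [|exact: bmeasZ|exact/bmeasZ/bmeas_sum].
  congr expect; apply/funext => eta.
  by rewrite -walk_avg_sum -!walk_avgZ -walk_avgD.
transitivity (2^-1 * expect (fun eta => walk_avg c n (fun y => K eta y o) o) +
  (2 * d)%:R^-1 * \sum_(i < d) expect (fun eta => walk_avg c n (fun y => K eta y o) (act c i o))).
  congr (_ + _ * _); apply: eq_bigr => i _.
  have sT := translation_shift c i; have [sA sC] := sT.
  rewrite -[RHS](expect_pull_edges invE sA)//; congr expect; apply/funext => eta.
  rewrite -shift_root -walk_avg_translation//; congr walk_avg.
  by apply/funext => y /=; rewrite invK// shiftK.
rewrite -(expect_sum invE)// -!(expectZ invE)//; last exact: bmeas_sum.
rewrite -(expectD invE)//; [exact: bmeasZ|exact/bmeasZ/bmeas_sum].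
Qed.

(** A function of the percolation seen from a vertex, with values in the unit
    interval. *)
Definition equivariant_field (f : config V -> V -> R) :=
  [/\ forall x, bmeas (fun eta => f eta x),
      forall eta x, 0 <= f eta x <= 1
    & forall g, translation c g -> forall eta x,
        f (pull_edges g eta) x = f eta (g x)].

(** The n-step kernel of the walk, restricted to pairs of connected vertices. *)
Definition cluster_avg n (f : config V -> V -> R) eta x : R :=
  walk_avg c n (fun y => (conn eta x y)%:R * f eta y) x.

Lemma bmeas_conn x y : bmeas (fun eta : config V => (conn eta x y)%:R : R).
Proof.
rewrite (_ : (fun _ => _) = fun eta => `[< [set eta : config V | conn eta x y] eta >]%:R).
  by apply: bmeas_event; apply: measurable_conn; exact: coding_countable c.
by apply/funext => eta; rewrite asboolb.
Qed.

Lemma field1 : equivariant_field (fun _ _ => 1).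
Proof. by split=> // [x|_ _]; [exact: bmeas_cst|rewrite lexx ler01]. Qed.

Lemma field_cluster_avg n f : equivariant_field f -> equivariant_field (cluster_avg n f).
Proof.
move=> [bf f01 invf]; split=> [x|eta x|g gT eta x].
- by apply: bmeas_walk_avg => y; exact/bmeasM/bf/bmeas_conn.
- have f0 eta' y : 0 <= f eta' y by case/andP: (f01 eta' y).
  have f1 eta' y : f eta' y <= 1 by case/andP: (f01 eta' y).
  rewrite walk_avg_ge0 ?walk_avg_le1// => y; last by rewrite mulr_ge0.
  by case: conn; rewrite ?mul1r ?mul0r.
have [[gbij _] gC] := gT.
rewrite /cluster_avg -walk_avg_translation//; congr walk_avg.
by apply/funext => y /=; rewrite invf// conn_pull_edges.
Qed.

Lemma field_level f t : equivariant_field f -> equivariant_field (fun eta x => (f eta x <= t)%R%:R).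
Proof.
move=> [bf _ invf]; split=> [x|eta x|g gT eta x]; last by rewrite invf.
  rewrite (_ : (fun _ => _) = fun eta => `[< [set eta | f eta x <= t] eta >]%:R).
    apply: bmeas_event; have [mf _] := bf x.
    rewrite (_ : [set _ | _] = setT `&` ((fun eta => f eta x) @^-1` `]-oo, t])).
      exact: mf.
    by rewrite setTI; apply/seteqP; split=> eta /=; rewrite in_itv.
  by apply/funext => eta; rewrite asboolb.
by case: (_ <= t); rewrite ?lexx ?ler01.
Qed.

Lemma cluster_avg_selfadjoint n f g : equivariant_field f -> equivariant_field g ->
  expect (fun eta => f eta o * cluster_avg n g eta o) =
  expect (fun eta => cluster_avg n f eta o * g eta o).
Proof.
move=> [bf _ invf] [bg _ invg].
pose K eta x y := f eta x * ((conn eta x y)%:R * g eta y) : R.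
transitivity (expect (fun eta => walk_avg c n (K eta o) o)).
  by congr expect; apply/funext => eta; rewrite /cluster_avg -walk_avgZ.
rewrite mass_transport => [|x y|h hT eta x y].
- congr expect; apply/funext => eta; rewrite mulrC -walk_avgZ; congr walk_avg.
  by apply/funext => y; rewrite /K conn_sym; lra.
- by apply: bmeasM => //; apply: bmeasM => //; exact: bmeas_conn.
- by have [[hbij _] _] := hT; rewrite /K invf// invg// conn_pull_edges.
Qed.

Lemma le_cluster_avg n f g eta x : (forall y, f eta y <= g eta y) ->
  cluster_avg n f eta x <= cluster_avg n g eta x.
Proof. by move=> fg; apply: le_walk_avg => y; rewrite ler_wpM2l. Qed.

(** A walk that is in the cluster at times n and n + m is in particular in the
    cluster at time n + m. *)
Lemma cluster_avg_comp n m f eta x : (forall y, 0 <= f eta y) ->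
  cluster_avg n (cluster_avg m f) eta x <= cluster_avg (n + m) f eta x.
Proof.
move=> f0; rewrite /cluster_avg walk_avg_add; apply: le_walk_avg => y.
case: (boolP (conn eta x y)) => xy; last first.
  by rewrite mul0r walk_avg_ge0// => z; rewrite mulr_ge0.
rewrite mul1r; apply: le_walk_avg => z.
by rewrite (conn_eq z xy).
Qed.

End MassTransport.

(** * Return probabilities at multiples of a time *)

Section ReturnProbability.
Variables (R : realType) (d : nat) (V : Type) (adj : rel V) (o : V).
Variable c : tree_coding d adj o.
Hypothesis d_gt0 : (0 < d)%N.
Variables (d0 : measure_display) (Omega : measurableType d0).
Variables (P : probability Omega R) (E : Omega -> rel V).
Hypothesis invE : invariant_percolation P adj E.
Implicit Types (eta : config V) (x y z : V) (f g : config V -> V -> R).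

Local Notation expect := (expect P E).

Lemma cluster_avgD n f g eta x :
  cluster_avg c n (fun eta y => f eta y + g eta y) eta x =
  cluster_avg c n f eta x + cluster_avg c n g eta x.
Proof.
rewrite /cluster_avg -walk_avgD; congr walk_avg.
by apply/funext => y; rewrite mulrDr.
Qed.

Lemma cluster_avgZ n a f eta x :
  cluster_avg c n (fun eta y => a * f eta y) eta x = a * cluster_avg c n f eta x.
Proof.
rewrite /cluster_avg -walk_avgZ; congr walk_avg.
by apply/funext => y; rewrite mulrCA.
Qed.

Lemma cluster_avg_ge0 n f eta x : (forall y, 0 <= f eta y) ->
  0 <= cluster_avg c n f eta x.
Proof. by move=> f0; apply: walk_avg_ge0 => y; rewrite mulr_ge0. Qed.

Lemma field_ge0 f eta x : equivariant_field c f -> 0 <= f eta x.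
Proof. by case=> _ /(_ eta x)/andP[]. Qed.

Lemma field_le1 f eta x : equivariant_field c f -> f eta x <= 1.
Proof. by case=> _ /(_ eta x)/andP[]. Qed.

Lemma field_bmeas f x : equivariant_field c f -> bmeas (fun eta => f eta x).
Proof. by case. Qed.

Definition return_prob n : config V -> V -> R := cluster_avg c n (fun _ _ => 1).

Lemma return_probE n eta x :
  return_prob n eta x = walk_avg c n (fun y => (conn eta x y)%:R) x.
Proof.
by congr walk_avg; apply/funext => y; rewrite mulr1.
Qed.

Lemma field_return_prob n : equivariant_field c (return_prob n).
Proof. exact/field_cluster_avg/field1. Qed.

Lemma return_prob0 eta x : return_prob 0 eta x = 1.
Proof. by rewrite return_probE /= conn_refl. Qed.

(** Laziness. *)
Lemma return_prob_half n eta x :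
  2^-1 * return_prob n eta x <= return_prob n.+1 eta x.
Proof. by rewrite !return_probE half_le_walk_avg. Qed.

Lemma return_prob_lower n eta x : 2^-1 ^+ n <= return_prob n eta x.
Proof.
elim: n => [|n IH]; first by rewrite return_prob0.
by rewrite exprS (le_trans _ (return_prob_half _ _ _))// ler_wpM2l// invr_ge0.
Qed.

Lemma return_prob_gt0 n eta x : 0 < return_prob n eta x.
Proof. by apply: lt_le_trans (return_prob_lower _ _ _); rewrite exprn_gt0// invr_gt0. Qed.

Definition iter_avg n j : config V -> V -> R :=
  iter j (cluster_avg c n) (fun _ _ => 1).

Lemma field_iter_avg n j : equivariant_field c (iter_avg n j).
Proof. by elim: j => [|j IH]; [exact: field1|exact: field_cluster_avg]. Qed.

Lemma iter_avg_le_return n j eta x : iter_avg n j eta x <= return_prob (j * n) eta x.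
Proof.
elim: j eta x => [|j IH] eta x; first by rewrite mul0n return_prob0.
rewrite mulSn /return_prob.
apply: le_trans (cluster_avg_comp c n (j * n) x _); last by move=> y; exact: ler01.
exact: le_cluster_avg.
Qed.

Lemma bmeas_return_prob n x : bmeas (fun eta => return_prob n eta x).
Proof. exact: field_bmeas x (field_return_prob n). Qed.

Lemma bmeas_iter_avg_level n j (t : R) x :
  bmeas (fun eta => (iter_avg n j eta x <= t)%R%:R : R).
Proof. exact: field_bmeas x (field_level t (field_iter_avg n j)). Qed.

(** By induction on j. The mass that the kernel sends from o to vertices where the
    j-th iterate is at most t^j has, by self-adjointness, the expectation bounded
    by the induction hypothesis; the mass sent to the other vertices contributes
    at least t^j times itself to the next iterate, so it is at most t when that
    iterate is at most t^(j+1). *)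
Lemma return_small_iter_avg n j (t : R) : 0 < t ->
  expect (fun eta => return_prob n eta o * (iter_avg n j.+1 eta o <= t ^+ j.+1)%R%:R)
  <= j.+1%:R * t.
Proof.
move=> t0; elim: j => [|j IH].
  rewrite mul1r -[leRHS](expect_cst P E t); apply: (le_expect invE).
  - apply: bmeasM; first exact: bmeas_return_prob.
    exact: bmeas_iter_avg_level.
  - exact: bmeas_cst.
  move=> eta; have [h|_] := leP (iter_avg n 1 eta o) (t ^+ 1).
    by rewrite mulr1.
  by rewrite mulr0 ltW.
pose small eta x : R := (iter_avg n j.+1 eta x <= t ^+ j.+1)%R%:R.
have fs : equivariant_field c small by exact/field_level/field_iter_avg.
have step eta : return_prob n eta o * (iter_avg n j.+2 eta o <= t ^+ j.+2)%R%:R <=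
    cluster_avg c n small eta o + t.
  have s0 : 0 <= cluster_avg c n small eta o.
    by apply: cluster_avg_ge0 => y; exact: field_ge0.
  have [hle|_] := leP (iter_avg n j.+2 eta o) _; last by rewrite mulr0 addr_ge0// ltW.
  rewrite mulr1; have tj : 0 < t ^+ j.+1 by rewrite exprn_gt0.
  apply: le_trans (_ : cluster_avg c n (fun eta y => small eta y +
     (t ^+ j.+1)^-1 * iter_avg n j.+1 eta y) eta o <= _).
    apply: le_cluster_avg => y; rewrite /small; have [_|hgt] /= := leP (iter_avg n j.+1 eta y) _.
      by rewrite lerDl mulr_ge0 ?invr_ge0 ?(ltW tj)// (field_ge0 _ _ (field_iter_avg n j.+1)).
    by rewrite add0r mulrC ler_pdivlMr// mul1r ltW.
  rewrite cluster_avgD cluster_avgZ lerD2l mulrC ler_pdivrMr// -exprS.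
have bs : bmeas (fun eta => cluster_avg c n small eta o).
  exact: (field_bmeas o (field_cluster_avg d_gt0 n fs)).
apply: le_trans (_ : expect (fun eta => cluster_avg c n small eta o + t) <= _).
  apply: (le_expect invE) => //.
  - apply: bmeasM; first exact: bmeas_return_prob.
    exact: bmeas_iter_avg_level.
  - by apply: bmeasD => //; exact: bmeas_cst.
rewrite (expectD invE)//; last exact: bmeas_cst.
rewrite expect_cst -[j.+2]addn1 natrD mulrDl mul1r lerD2r.
apply: le_trans IH.
have := cluster_avg_selfadjoint invE n (field1 R c) fs.
by under eq_fun do rewrite mul1r; move=> ->.
Qed.

Lemma dyadic_bracket n (a : R) : 2^-1 ^+ n <= a -> a <= 1 ->
  exists2 i, (i <= n)%N & 2^-1 ^+ i.+1 <= a <= 2^-1 ^+ i.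
Proof.
move=> + a1; elim: n => [|n IH] an.
  by exists 0%N => //; rewrite a1 andbT (le_trans _ an)// expr1 expr0; lra.
have [/IH[i iN ai]|/ltW an'] := leP (2^-1 ^+ n) a.
  by exists i => //; exact: leqW.
by exists n => //; rewrite an an'.
Qed.

Lemma bad_scale_event_meas n j (s : R) :
  measurable [set eta | return_prob (j * n) eta o <= (s * return_prob n eta o) ^+ j].
Proof.
have [m1 _] := field_bmeas o (field_return_prob (j * n)).
have [m2 _] := bmeasX j (bmeasZ s (field_bmeas o (field_return_prob n))).
have := measurable_fun_ler m1 m2.
move=> /(_ measurableT [set true] I); rewrite setTI.
by congr (measurable _); apply/seteqP; split.
Qed.

(** [return_small_iter_avg] is used with t = s 2^-i, where 2^-i is the dyadic scale of the
    return probability; laziness leaves only n + 1 scales. *)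
Lemma bad_scale_bound n j (s : R) : 0 < s ->
  (P [set w | (return_prob (j.+1 * n) (E w) o <= (s * return_prob n (E w) o) ^+ j.+1)%R]
   <= (2 * j.+1%:R * n.+1%:R * s)%R%:E)%E.
Proof.
move=> s0; rewrite -(expect_event invE (bad_scale_event_meas n j.+1 s)) lee_fin.
pose G i eta := return_prob n eta o *
  (iter_avg n j.+1 eta o <= (s * 2^-1 ^+ i) ^+ j.+1)%R%:R.
have bG i : bmeas (G i).
  apply: bmeasM; first exact: bmeas_return_prob.
  exact: bmeas_iter_avg_level.
(* On the event, the summand at the dyadic scale of the return probability is at
   least 1. *)
apply: le_trans (_ : expect (fun eta => \sum_(i < n.+1) 2 ^+ i.+1 * G i eta) <= _).
  apply: (le_expect invE).
  - exact: bmeas_event (bad_scale_event_meas n j.+1 s).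
  - by apply: bmeas_sum => i; exact: bmeasZ.
  move=> eta; have G0 i : 0 <= G i eta by rewrite mulr_ge0// ltW// return_prob_gt0.
  case: asboolP => [/= bad|_]; last by apply: sumr_ge0 => i _; rewrite mulr_ge0.
  have [i iN /andP[ai1 ai2]] := dyadic_bracket (return_prob_lower n eta o)
    (field_le1 eta o (field_return_prob n)).
  apply: le_trans (_ : 2 ^+ i.+1 * G i eta <= _); last first.
    rewrite (bigD1 (Ordinal (iN : (i < n.+1)%N)))//= lerDl.
    by apply: sumr_ge0 => k _; rewrite mulr_ge0.
  have hG : iter_avg n j.+1 eta o <= (s * 2^-1 ^+ i) ^+ j.+1.
    apply: le_trans (iter_avg_le_return _ _ _ _) _; apply: le_trans bad _.
    rewrite lerXn2r ?nnegrE ?mulr_ge0 ?(ltW s0) ?exprn_ge0 ?invr_ge0//.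
      exact/ltW/return_prob_gt0.
    by rewrite ler_pM2l.
  by rewrite /G hG mulr1 -ler_pdivrMl ?exprn_gt0// mulr1 -exprVn.
rewrite (expect_sum invE) => [|i]; last exact: bmeasZ.
apply: le_trans (_ : \sum_(i < n.+1) 2 * j.+1%:R * s <= _); last first.
  by rewrite sumr_const card_ord -[leLHS]mulr_natr; lra.
apply: ler_sum => i _; rewrite (expectZ invE)//.
have := return_small_iter_avg n j (t := s * 2^-1 ^+ i).
rewrite mulr_gt0 ?exprn_gt0 ?invr_gt0// => /(_ isT) H.
apply: le_trans (ler_wpM2l _ H) _; first by rewrite exprn_ge0.
rewrite le_eqVlt; apply/orP; left; apply/eqP.
have e : 2 ^+ i * 2^-1 ^+ i = 1 :> R by rewrite -exprMn divff ?expr1n// pnatr_eq0.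
by rewrite exprS; transitivity (2 * j.+1%:R * s * (2 ^+ i * 2^-1 ^+ i)); [lra|rewrite e mulr1].
Qed.

End ReturnProbability.

(** * Almost sure convergence of the quenched rate *)

Section LogLoss.
Variable R : realType.

(** The exponent 9 makes the sum over j < n^3 of 2 (j + 1) (n + 1) (n + 2)^-9 of
    order n^-2, hence summable; only its logarithm matters for the rates. *)
Definition scale_loss n : R := n.+2%:R^-1 ^+ 9.

Definition log_loss n : R := - ln (scale_loss n) / n%:R.

Lemma scale_loss_gt0 n : 0 < scale_loss n.
Proof. by rewrite exprn_gt0// invr_gt0. Qed.

Lemma log_lossE n : log_loss n = 9 * ln (n.+2%:R) / n%:R.
Proof.
by rewrite /log_loss lnXn ?invr_gt0// lnV ?posrE// -mulNrn opprK mulr_natl.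
Qed.

Lemma log_loss_ge0 n : 0 <= log_loss n.
Proof. by rewrite log_lossE mulr_ge0 ?invr_ge0// mulr_ge0// ln_ge0// ler1n. Qed.

(** The losses made by squaring the time repeatedly add up to at most twice the
    first of them. *)
Lemma log_loss_square n : (4 <= n)%N -> 2 * log_loss (n * n)%N <= log_loss n.
Proof.
move=> n4; rewrite !log_lossE.
have nR : 4 <= n%:R :> R by rewrite ler_nat.
have l0 : 0 <= ln (n.+2%:R) :> R by rewrite ln_ge0// ler1n.
have l2 : ln ((n * n).+2%:R) <= 2 * ln (n.+2%:R) :> R.
  rewrite mulr_natl -lnXn// ler_ln ?posrE ?exprn_gt0// -natrX ler_nat expnS expn1.
  by lia.
rewrite ler_pdivlMr; last by lra.
rewrite natrM invfM !mulrA mulfVK; last by apply/eqP; lra.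
rewrite ler_pdivrMr; last by lra.
have : 0 <= ln (n.+2%:R) * (n%:R - 4) :> R by rewrite mulr_ge0// subr_ge0.
lra.
Qed.

Lemma cvg_log_loss : log_loss @ \oo --> 0.
Proof.
apply/cvgrPdist_le => e e0.
exists (Num.bound ((36 / e) ^+ 2)).+1 => // n /= Nn.
have n0 : (0 < n)%N by exact: leq_trans Nn.
have nR : 1 <= n%:R :> R by rewrite ler1n.
rewrite sub0r normrN ger0_norm ?log_loss_ge0// log_lossE ler_pdivrMr; last lra.
set s := Num.sqrt (n%:R : R).
have ss : s ^+ 2 = n%:R by rewrite sqr_sqrtr//; lra.
have s0 : 0 <= s by exact: sqrtr_ge0.
have se : 36 / e <= s.
  rewrite -(@ler_pXn2r _ 2)// ?nnegrE ?divr_ge0 ?(ltW e0)// ss.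
  apply: le_trans (ltW (archi_boundP _)) _; first exact: sqr_ge0.
  by rewrite ler_nat ltnW.
have es : 36 <= e * s by rewrite mulrC -ler_pdivrMr.
have s1 : 0 < s by rewrite lt_neqAle s0 andbT; apply/eqP => s00; move: ss; rewrite -s00 expr2; lra.
have l1 : ln (n.+2%:R) <= 2 * (2 * s).
  have : ln ((2 * s) ^+ 2) <= 2 * (2 * s).
    rewrite lnXn ?mulr_gt0// mulr2n.
    have := @le_ln1Dx R (2 * s - 1).
    by rewrite (addrC 1) subrK => H; have := H ltac:(lra); lra.
  apply: le_trans; rewrite ler_ln ?posrE ?exprn_gt0 ?mulr_gt0//.
  rewrite exprMn ss -[n.+2]addn2 natrD; lra.
rewrite -ss expr2; nra.
Qed.

End LogLoss.

Lemma nneseries_le (R : realType) (u : nat -> \bar R) (M : \bar R) :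
  (forall n, 0 <= u n)%E -> (forall n, \sum_(0 <= i < n) u i <= M)%E ->
  (\sum_(0 <= i <oo) u i <= M)%E.
Proof.
move=> u0 uM; apply: lime_le; first by apply: is_cvg_nneseries => i _ _.
by apply: nearW => n; exact: uM.
Qed.

Section Quenched.
Variables (R : realType) (d : nat) (V : Type) (adj : rel V) (o : V).
Variable c : tree_coding d adj o.
Hypothesis d_gt0 : (0 < d)%N.
Variables (d0 : measure_display) (Omega : measurableType d0).
Variables (P : probability Omega R) (E : Omega -> rel V).
Hypothesis invE : invariant_percolation P adj E.
Implicit Types (eta : config V).

Local Notation a n eta := (return_prob R c n eta o).

Definition decay_rate n eta : R := - ln (a n eta) / n%:R.

Let a_gt0 n eta : 0 < a n eta. Proof. exact: return_prob_gt0. Qed.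

Let a_le1 n eta : a n eta <= 1.
Proof. exact: field_le1 (field_return_prob R c d_gt0 n). Qed.

Lemma return_prob_decay n eta : (0 < n)%N -> a n eta = expR (- (n%:R * decay_rate n eta)).
Proof.
move=> n0; rewrite /decay_rate mulrCA divff ?pnatr_eq0 -?lt0n// mulr1 opprK.
by rewrite lnK// posrE.
Qed.

Lemma decay_rate_ge0 n eta : 0 <= decay_rate n eta.
Proof. by rewrite divr_ge0// oppr_ge0 ln_le0. Qed.

Lemma return_prob_slow k m eta : (k <= m)%N -> 2^-1 ^+ (m - k) * a k eta <= a m eta.
Proof.
move=> /subnK <-; rewrite addnK; elim: (m - k)%N => [|i IH]; first by rewrite mul1r.
rewrite exprS -mulrA addSn; apply: le_trans (return_prob_half _ _ _ _ _).
by rewrite ler_pM2l.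
Qed.

Lemma decay_rate_slow k m eta : (k <= m)%N ->
  m%:R * decay_rate m eta <= k%:R * decay_rate k eta + (m - k)%:R * ln 2.
Proof.
have nd i : i%:R * decay_rate i eta = - ln (a i eta).
  rewrite /decay_rate; case: i => [|i]; last by rewrite mulrCA divff ?mulr1.
  by rewrite mul0r return_prob0 ln1 oppr0.
move=> km; rewrite !nd -lerBlDr lerNr opprB.
have : ln (2^-1 ^+ (m - k) * a k eta) <= ln (a m eta).
  by rewrite ler_ln ?posrE ?mulr_gt0 ?exprn_gt0 ?invr_gt0// return_prob_slow.
rewrite lnM ?posrE ?exprn_gt0 ?invr_gt0// lnXn ?invr_gt0// lnV ?posrE//.
by rewrite -[(- ln 2) *+ _]mulr_natl mulrN; lra.
Qed.

Lemma decay_rate_le n eta : decay_rate n eta <= ln 2.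
Proof.
case: n => [|n]; first by rewrite /decay_rate invr0 mulr0 ln_ge0// ler1n.
have := @decay_rate_slow 0 n.+1 eta (leq0n _).
by rewrite mul0r add0r subn0 ler_pM2l// ltr0n.
Qed.

Definition multiple_fails n j : set Omega :=
  [set w | (a (j.+1 * n) (E w) <= (scale_loss R n * a n (E w)) ^+ j.+1)%R].

(** Multiples up to n^3 lead from the times between n^2 and n^4 back to n. *)
Definition multiples_fail n := \big[setU/set0]_(j < n ^ 3) multiple_fails n j.

Let measurable_multiple_fails n j : measurable (multiple_fails n j).
Proof.
have := measurable_config_map invE measurableT (bad_scale_event_meas c d_gt0 n j.+1 (scale_loss R n)).
by rewrite setTI.
Qed.

Let measurable_multiples_fail n : measurable (multiples_fail n).
Proof. exact: bigsetU_measurable. Qed.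

Let bad_bound n : (P (multiples_fail n) <= (2 / (n.+1%:R * n.+2%:R))%:E)%E.
Proof.
apply: le_trans (Boole_inequality P (A := multiple_fails n) (n := n ^ 3) _) _ => //.
apply: le_trans (_ : (\sum_(j < n ^ 3) (2 * (n ^ 3)%:R * n.+1%:R * scale_loss R n)%R%:E <= _)%E).
  apply: lee_sum => j _.
  apply: le_trans (bad_scale_bound c d_gt0 invE n j (scale_loss_gt0 R n)) _.
  rewrite lee_fin ler_wpM2r ?(ltW (scale_loss_gt0 _ _))// ler_wpM2r// ler_wpM2l//.
  by rewrite ler_nat.
rewrite sumEFin lee_fin sumr_const card_ord -[leLHS]mulr_natl.
have n2 : n.+2%:R != 0 :> R by [].
have n1 : 0 < n.+1%:R :> R by [].
have n2' : 0 < n.+2%:R :> R by [].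
rewrite /scale_loss exprVn ler_pdivlMr ?mulr_gt0//.
have -> : forall x y z u : R, x * (2 * x * y * u) * (y * z) = 2 * (x * x * y * y * z * u).
  by move=> x y z u; lra.
rewrite -[leRHS]mulr1 ler_pM2l// ler_pdivrMr ?exprn_gt0// mul1r -!natrM -natrX ler_nat.
rewrite !expnS expn0 !muln1; nia.
Qed.

(** By Borel-Cantelli. *)
Lemma ae_decay_rate_multiples : {ae P, forall w, \forall n \near \oo,
  forall j, (0 < j <= n ^ 3)%N ->
    decay_rate (j * n) (E w) <= decay_rate n (E w) + log_loss R n}.
Proof.
have sumbad : (\sum_(0 <= n <oo) P (multiples_fail n) <= 2%:E)%E.
  apply: nneseries_le => // n.
  apply: le_trans (_ : (2 - 2 / n.+1%:R)%:E <= _)%E; last first.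
    by rewrite lee_fin gerBl divr_ge0.
  elim: n => [|n IH]; first by rewrite big_geq// lee_fin; lra.
  rewrite big_nat_recr//=; apply: le_trans (leeD IH (bad_bound n)) _.
  rewrite -EFinD lee_fin invfM.
  set x := n.+1%:R^-1; set y := n.+2%:R^-1.
  have h1 : x * (y * (n.+1%:R + 1)) = x by rewrite natr1 mulVf ?mulr1.
  have h2 : y * (x * n.+1%:R) = y by rewrite mulVf ?mulr1.
  lra.
have null : P (lim_sup_set multiples_fail) = 0%E.
  by apply: lim_sup_set_cvg0 => //; exact: le_lt_trans sumbad (ltry _).
have mlim : measurable (lim_sup_set multiples_fail).
  by apply: bigcap_measurable => [|n _]; [exists 0%N|exact: bigcup_measurable].
exists (lim_sup_set multiples_fail); split=> //.
move=> w /= nw; apply: contrapT => nlim; apply: nw.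
have [N notbad] : exists N, forall n, (N <= n)%N -> ~ multiples_fail n w.
  apply: contrapT => H; apply: nlim => N _; apply: contrapT => H'.
  by apply: H; exists N => n Nn bn; apply: H'; exists n.
exists (maxn N 1) => // n; rewrite /= geq_max => /andP[Nn n1] j /andP[j0 jn].
have nb : (scale_loss R n * a n (E w)) ^+ j < a (j * n) (E w).
  rewrite ltNge; apply/negP => H; apply: (notbad n Nn).
  rewrite /multiples_fail -bigcup_mkord; exists j.-1; first by rewrite /= prednK.
  by rewrite /multiple_fails /= prednK.
have jR : 0 < j%:R :> R by rewrite ltr0n.
have nR : 0 < n%:R :> R by rewrite ltr0n.
have sa : 0 < scale_loss R n * a n (E w) by rewrite mulr_gt0// scale_loss_gt0.
have : ln ((scale_loss R n * a n (E w)) ^+ j) <= ln (a (j * n) (E w)).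
  by rewrite ler_ln ?posrE ?exprn_gt0// ltW.
rewrite lnXn// lnM ?posrE ?scale_loss_gt0// -[(ln _ + _) *+ _]mulr_natl => H.
rewrite /decay_rate /log_loss -mulrDl natrM invfM mulrA ler_pM2r ?invr_gt0//.
rewrite ler_pdivrMr// mulrC; lra.
Qed.

Lemma ae_cvg_decay_rate : {ae P, forall w, cvgn (fun n => decay_rate n (E w))}.
Proof.
apply: filterS ae_decay_rate_multiples => w mult.
apply: (@cvg_of_multiples R _ (@log_loss R) (ln 2)).
- by move=> n; rewrite decay_rate_ge0 decay_rate_le.
- exact: log_loss_ge0.
- exact: cvg_log_loss.
- exact: log_loss_square.
- exact: mult.
- by move=> k m; exact: decay_rate_slow.
Qed.

End Quenched.

(** * The annealed rate *)

Section Annealed.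
Variables (R : realType) (d : nat) (V : Type) (adj : rel V) (o : V).
Variable c : tree_coding d adj o.
Hypothesis d_gt0 : (0 < d)%N.
Variables (d0 : measure_display) (Omega : measurableType d0).
Variables (P : probability Omega R) (E : Omega -> rel V).
Hypothesis invE : invariant_percolation P adj E.
Implicit Types (eta : config V) (f g : config V -> V -> R).

Local Notation expect := (expect P E).
Local Notation a n eta := (return_prob R c n eta o).

Lemma expect_dominated_cvg (F : nat -> config V -> R) (M L : R) :
  (forall n, bmeas (F n)) -> (forall n eta, `|F n eta| <= M) ->
  {ae P, forall w, (fun n => F n (E w)) @ \oo --> L} ->
  (fun n => expect (F n)) @ \oo --> L.
Proof.
move=> bF FM Fcvg.
have M0 : 0 <= M.
  have [w _] : [set: Omega] !=set0.
    apply/set0P/eqP => O0; have := @probability_setT _ _ _ P.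
    by rewrite O0 measure0 => -[] /eqP; rewrite eq_sym oner_eq0.
  exact: le_trans (normr_ge0 _) (FM 0%N (E w)).
have [] := @dominated_convergence _ Omega R P setT measurableT
  (fun n w => (F n (E w))%:E) (cst L%:E) (cst M%:E).
- by move=> n; apply/measurable_EFinP; exact: (bmeas_measurable invE (bF n)).
- exact: measurable_cst.
- apply: filterS Fcvg => w Fw _.
  apply: cvg_EFin Fw; exact: nearW.
- exact: finite_measure_integrable_cst.
- by apply: aeW => w n _ /=; rewrite lee_fin.
have -> : (\int[P]_x cst L%:E x = L%:E)%E.
  rewrite integral_cst// -[RHS]mule1; congr (_ * _)%E; exact: probability_setT.
move=> _ _ H.
have -> : (fun n => expect (F n)) =
    fine \o (fun n => (\int[P]_w (F n (E w))%:E)%E) by [].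
exact: (fine_cvg H).
Qed.

Section SpectralLower.
Variable n : nat.

Definition avg_pow i f := iter i (cluster_avg c n) f.

Lemma field_avg_pow i f : equivariant_field c f -> equivariant_field c (avg_pow i f).
Proof. by move=> ff; elim: i => //= i IH; exact: field_cluster_avg. Qed.

Lemma avg_pow_selfadjoint i f g : equivariant_field c f -> equivariant_field c g ->
  expect (fun eta => f eta o * avg_pow i g eta o) =
  expect (fun eta => avg_pow i f eta o * g eta o).
Proof.
move=> ff fg; elim: i f ff => [//|i IH] f ff.
transitivity (expect (fun eta => cluster_avg c n f eta o * avg_pow i g eta o)).
  exact: (cluster_avg_selfadjoint invE n ff (field_avg_pow i fg)).
rewrite IH; last exact: field_cluster_avg.
by rewrite /avg_pow -iterSr.
Qed.

Let bmeas_prod f g : equivariant_field c f -> equivariant_field c g ->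
  bmeas (fun eta => f eta o * g eta o).
Proof. by move=> ff fg; exact: (bmeasM (field_bmeas o ff) (field_bmeas o fg)). Qed.

(** Cauchy-Schwarz for the self-adjoint kernel doubles the exponent at each step. *)
Lemma spectral_moment_pow f k : equivariant_field c f ->
  expect (fun eta => f eta o * cluster_avg c n f eta o) ^+ (2 ^ k) <=
  expect (fun eta => f eta o * avg_pow (2 ^ k) f eta o).
Proof.
move=> ff; elim: k => [|k IH]; first by rewrite expr1.
rewrite expnSr exprM; set i := (2 ^ k)%N in IH *.
have fi := field_avg_pow i ff.
have s0 : 0 <= expect (fun eta => f eta o * cluster_avg c n f eta o).
  apply: expect_ge0 => eta; rewrite mulr_ge0//; first exact: (field_ge0 eta o ff).
  by apply: cluster_avg_ge0 => y; exact: (field_ge0 eta y ff).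
apply: le_trans (_ : expect (fun eta => f eta o * avg_pow i f eta o) ^+ 2 <= _).
  by rewrite lerXn2r ?nnegrE ?exprn_ge0// (le_trans _ IH)// exprn_ge0.
apply: le_trans (expect_sqr_le invE (bmeas_prod ff fi)) _.
apply: le_trans (_ : expect (fun eta => avg_pow i f eta o * avg_pow i f eta o) <= _).
  apply: (le_expect invE); [exact/bmeasX/bmeas_prod|exact: bmeas_prod|move=> eta].
  have f0 := field_ge0 eta o ff; have f1 := field_le1 eta o ff.
  have g0 := field_ge0 eta o fi.
  rewrite exprMn -expr2 ler_piMl ?exprn_ge0// expr_le1//.
rewrite -(avg_pow_selfadjoint i ff fi) /avg_pow -iterD addnn -mul2n mulnC//.
Qed.

End SpectralLower.

(** Let f be the indicator that the return probability at time 2^k n is at most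
    t^(2^k). The moments of the kernel at f are controlled by that return
    probability, so the kernel has value at most t at f; replacing f by 1 on both
    sides costs the probability that f vanishes, twice. *)
Lemma expect_return_le_level n k (t : R) : 0 <= t ->
  expect (fun eta => a n eta) <= t +
   2 * (1 - expect (fun eta => (a (2 ^ k * n) eta <= t ^+ (2 ^ k))%R%:R)).
Proof.
move=> t0.
pose f eta x : R := (return_prob R c (2 ^ k * n) eta x <= t ^+ (2 ^ k))%R%:R.
have ff : equivariant_field c f by exact/field_level/field_return_prob.
have fQ : equivariant_field c (cluster_avg c n f) by exact: field_cluster_avg.
have fa := field_return_prob R c d_gt0 n.
have bf := field_bmeas o ff; have bQ := field_bmeas o fQ; have ba := field_bmeas o fa.
have bfQ := bmeasM bf bQ.
have s1 : expect (fun eta => f eta o * cluster_avg c n f eta o) <= t.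
  rewrite -(@ler_pXn2r _ (2 ^ k))// ?expn_gt0// ?nnegrE//; last first.
    by apply: expect_ge0 => eta; rewrite mulr_ge0// (field_ge0 eta o ff, field_ge0 eta o fQ).
  apply: le_trans (spectral_moment_pow n k ff) _.
  rewrite -[leRHS](expect_cst P E); apply: (le_expect invE).
  - exact: (bmeasM bf (field_bmeas o (field_avg_pow n (2 ^ k) ff))).
  - exact: bmeas_cst.
  move=> eta; have Q1 : avg_pow n (2 ^ k) f eta o <= a (2 ^ k * n) eta.
    apply: le_trans; last exact: iter_avg_le_return.
    suff H i x : avg_pow n i f eta x <= iter_avg R c n i eta x by exact: H.
    elim: i x => [|i IH] x; first exact: (field_le1 eta x ff).
    by apply: le_cluster_avg => y; exact: IH.
  rewrite {1}/f; have [h|_] := leP (a (2 ^ k * n) eta) (t ^+ (2 ^ k)).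
    by rewrite mul1r (le_trans Q1).
  by rewrite mul0r exprn_ge0.
have e1 : expect (fun eta => a n eta * f eta o) = expect (fun eta => cluster_avg c n f eta o).
  have := cluster_avg_selfadjoint invE n (field1 R c) ff.
  by under eq_fun do rewrite mul1r; move=> ->.
have e2 : expect (fun eta => a n eta) - expect (fun eta => a n eta * f eta o) <=
    1 - expect (fun eta => f eta o).
  rewrite -(expectB invE)//; last exact: bmeasM.
  rewrite -[1](expect_cst P E) -(expectB invE)//; last exact: bmeas_cst.
  apply: (le_expect invE); [exact/bmeasB/bmeasM|exact/bmeasB/bf/bmeas_cst|].
  move=> eta; have := field_le1 eta o fa; have := field_le1 eta o ff.
  by rewrite -!(subr_ge0 _ 1) => f1 a1; have := mulr_ge0 a1 f1; lra.
have e3 : expect (fun eta => cluster_avg c n f eta o) -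
    expect (fun eta => f eta o * cluster_avg c n f eta o) <=
    1 - expect (fun eta => f eta o).
  rewrite -(expectB invE)// -[1](expect_cst P E) -(expectB invE)//; last exact: bmeas_cst.
  apply: (le_expect invE); [exact: bmeasB|exact/bmeasB/bf/bmeas_cst|].
  move=> eta; have := field_le1 eta o fQ; have := field_le1 eta o ff.
  by rewrite -!(subr_ge0 _ 1) => f1 a1; have := mulr_ge0 a1 f1; lra.
by move: s1; lra.
Qed.

Lemma bmeas_decay_rate n : bmeas (decay_rate R c n : config V -> R).
Proof.
split; last first.
  by exists (ln 2) => eta; rewrite ger0_norm ?decay_rate_le ?decay_rate_ge0.
have [ma _] := bmeas_return_prob R c d_gt0 n o.
apply: measurable_funM; last exact: measurable_cst.
apply: measurable_funN; exact: measurableT_comp (@measurable_ln R) ma.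
Qed.

Definition annealed_rate n : R := - ln (expect (fun eta => a n eta)) / n%:R.

Lemma expect_return_gt0 n : 0 < expect (fun eta => a n eta).
Proof.
apply: lt_le_trans (_ : expect (fun=> 2^-1 ^+ n) <= _).
  by rewrite expect_cst exprn_gt0// invr_gt0.
apply: (le_expect invE); [exact: bmeas_cst|exact: bmeas_return_prob|].
by move=> eta; exact: return_prob_lower.
Qed.

(** Jensen's inequality: the exponential is above its tangent at the mean. *)
Lemma annealed_rate_le n : (0 < n)%N -> annealed_rate n <= expect (decay_rate R c n).
Proof.
move=> n0; have nR : 0 < n%:R :> R by rewrite ltr0n.
set m := expect (decay_rate R c n).
rewrite ler_pdivrMr// lerNl -ler_expR lnK ?posrE ?expect_return_gt0//.
have bd := bmeas_decay_rate n.
have <- : expect (fun eta => expR (- (m * n%:R)) * (1 + (n%:R * m + - n%:R * decay_rate R c n eta))) =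
    expR (- (m * n%:R)).
  rewrite (expectZ invE); last first.
    apply: bmeasD; first exact: bmeas_cst.
    by apply: bmeasD; [exact: bmeas_cst|exact: bmeasZ].
  rewrite (expectD invE); [|exact: bmeas_cst|by apply: bmeasD; [exact: bmeas_cst|exact: bmeasZ]].
  rewrite (expectD invE); [|exact: bmeas_cst|exact: bmeasZ].
  by rewrite !expect_cst (expectZ invE)// -/m mulNr subrr addr0 mulr1.
apply: (le_expect invE).
- apply: bmeasZ; apply: bmeasD; first exact: bmeas_cst.
  by apply: bmeasD; [exact: bmeas_cst|exact: bmeasZ].
- exact: bmeas_return_prob.
move=> eta; rewrite (return_prob_decay _ _ _ n0).
rewrite (_ : - (n%:R * decay_rate R c n eta) =
  - (m * n%:R) + (n%:R * m + - n%:R * decay_rate R c n eta)); last by lra.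
by rewrite expRD ler_pM2l ?expR_gt0// expR_ge1Dx.
Qed.

Section ConstantRate.
Variable l : R.
Hypothesis rate_cvg : {ae P, forall w, (fun n => decay_rate R c n (E w)) @ \oo --> l}.

(** Any t larger than exp (- n l) satisfies the bound on the mean return
    probability, since the event excluded by the truncation becomes negligible as
    k grows. *)
Lemma annealed_rate_ge n : (0 < n)%N -> l <= annealed_rate n.
Proof.
move=> n0; have nR : 0 < n%:R :> R by rewrite ltr0n.
apply/ler_addgt0Pr => e e0; rewrite -lerBlDr.
rewrite ler_pdivlMr// lerNr -ler_expR lnK ?posrE ?expect_return_gt0//.
set t := expR _; have t0 : 0 < t by exact: expR_gt0.
(* The indicator of the truncation in [expect_return_le_level]. *)
pose F k eta : R := (a (2 ^ k * n) eta <= t ^+ (2 ^ k))%R%:R.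
have Fcvg : (fun k => expect (F k)) @ \oo --> (1 : R).
  apply: (@expect_dominated_cvg _ 1).
  - move=> k; apply: (field_bmeas o (field_level (t ^+ (2 ^ k)) (field_return_prob R c d_gt0 (2 ^ k * n)))).
  - move=> k eta; rewrite /F.
    by case: (a (2 ^ k * n) eta <= t ^+ (2 ^ k))%R; rewrite ?normr1 ?normr0.
  apply: filterS rate_cvg => w /cvgrPdist_le/(_ _ e0)[N _ HN].
  apply/cvgrPdist_le => e' e'0; exists N => // k /= Nk.
  suff hF : a (2 ^ k * n) (E w) <= t ^+ (2 ^ k) by rewrite /F hF subrr normr0 ltW.
  have kn : (N <= 2 ^ k * n)%N.
    apply: leq_trans Nk _; rewrite (leq_trans (ltnW (ltn_expl k (ltnSn 1))))//.
    by rewrite leq_pmulr.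
  have kn0 : (0 < 2 ^ k * n)%N by rewrite muln_gt0 expn_gt0.
  have := HN _ kn; rewrite ler_norml => /andP[_ H].
  rewrite (return_prob_decay _ _ _ kn0) /t -expRM_natl ler_expR mulrN lerN2.
  rewrite mulrCA -natrM mulrC ler_wpM2l//; lra.
apply/ler_addgt0Pr => e' e'0.
have e'2 : 0 < e' / 2 by rewrite divr_gt0.
move/cvgrPdist_le : Fcvg => /(_ _ e'2)[N _ /(_ N (leqnn N))].
rewrite /= ler_norml => /andP[_ HN].
apply: le_trans (expect_return_le_level n N (ltW t0)) _.
by move: HN; rewrite /F; lra.
Qed.

Lemma cvg_annealed_rate : annealed_rate @ \oo --> l.
Proof.
apply: (@squeeze_cvgr _ _ _ _ (fun=> l) (fun n => expect (decay_rate R c n))).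
- by exists 1%N => // n n1; rewrite annealed_rate_ge ?annealed_rate_le.
- exact: cvg_cst.
- apply: (@expect_dominated_cvg _ (ln 2)) => //.
  + exact: bmeas_decay_rate.
  + by move=> n eta; rewrite ger0_norm ?decay_rate_le ?decay_rate_ge0.
Qed.

End ConstantRate.
End Annealed.

(** * The radial kernel of the lazy walk *)

Section RadialKernel.
Variables (R : realType) (d : nat).
Hypothesis d_gt0 : (0 < d)%N.

(** The probability that the lazy walk goes in n steps to a given vertex at
    distance k: among the d neighbours of a vertex distinct from the target, one
    is closer and d - 1 are farther. *)
Fixpoint radial n k : R :=
  if n is n'.+1 then
    2^-1 * radial n' k + (2 * d)%:R^-1 *
      (if k is k'.+1 then radial n' k' + d.-1%:R * radial n' k'.+2
       else d%:R * radial n' 1)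
  else (k == 0)%:R.

Lemma radial_ge0 n k : 0 <= radial n k.
Proof.
elim: n k => [|n IH] k //=; rewrite addr_ge0 ?mulr_ge0 ?invr_ge0//.
by case: k => [|k]; rewrite ?addr_ge0 ?mulr_ge0.
Qed.

Lemma radial_succ_ge n k : (2 * d)%:R^-1 * radial n k <= radial n.+1 k.+1.
Proof.
rewrite /= mulrDr addrCA lerDl addr_ge0// ?mulr_ge0 ?invr_ge0//; exact: radial_ge0.
Qed.

Lemma radial_shift m n k : radial n k <= (2 * d)%:R ^+ m * radial (m + n) (m + k).
Proof.
have D0 : 0 < (2 * d)%:R :> R by rewrite ltr0n muln_gt0.
elim: m => [|m IH]; first by rewrite mul1r.
apply: le_trans IH _; rewrite exprSr -mulrA ler_pM2l ?exprn_gt0//.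
by rewrite -ler_pdivrMl// radial_succ_ge.
Qed.

(** This allows the length of any walk to be used as an upper bound for the
    distance, without mentioning distances in an arbitrary graph. *)
Lemma radial_nonincreasing n k k' : (k <= k')%N -> radial n k' <= radial n k.
Proof.
have D0 : 0 < d%:R :> R by rewrite ltr0n.
suff step i : radial n i.+1 <= radial n i.
  by move=> /subnK <-; elim: (k' - k)%N => // i IH; exact: le_trans (step _) IH.
elim: n i => [|n IH] [|i] //=.
  have h0 := IH 0%N; have h1 := IH 1%N.
  set u := d%:R^-1 : R; have uv : u + d.-1%:R * u = 1.
    by rewrite -{1}[u]mul1r -mulrDl nat1r prednK// divff// gt_eqF.
  have v0 : 0 <= d.-1%:R * u * (radial n 0 - radial n 2).
    by rewrite mulr_ge0 ?mulr_ge0 ?invr_ge0 ?(ltW D0)// subr_ge0 (le_trans h1).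
  have ud : d%:R * u = 1 by rewrite divff// gt_eqF.
  rewrite natrM invfM -/u.
  have -> : 2^-1 * u * (d%:R * radial n 1) = 2^-1 * radial n 1.
    by rewrite mulrA -(mulrA 2^-1) (mulrC u) ud mulr1.
  have e0 : radial n 0 = u * radial n 0 + d.-1%:R * u * radial n 0.
    by rewrite -mulrDl uv mul1r.
  lra.
apply: lerD; first by rewrite ler_wpM2l.
by rewrite ler_wpM2l ?invr_ge0// lerD ?ler_wpM2l.
Qed.

Variables (V : Type) (adj : rel V) (o : V).
Variable c : tree_coding d adj o.

Lemma sum_letter (f : nat -> R) (w : seq 'I_d) : \sum_(i < d) f (size (letter i w)) =
  if w is j :: w' then f (size w') + d.-1%:R * f (size w').+2 else d%:R * f 1%N.
Proof.
case: w => [|j w] /=.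
  by rewrite sumr_const card_ord mulr_natl.
rewrite (bigD1 j)//= eqxx; congr (_ + _).
rewrite (eq_bigr (fun=> f (size w).+2)) => [|i /negbTE ->//].
by rewrite sumr_const mulr_natl; congr (_ *+ _); rewrite cardC1 card_ord.
Qed.

Lemma walk_avg_radial n x : walk_avg c n (dirac_fun R o) x = radial n (size (word_of c x)).
Proof.
elim: n x => [|n IH] x.
  rewrite /= /dirac_fun; case: asboolP => [<-|ox]; first by rewrite word_of_root.
  case: eqP => // /size0nil x0; case: ox; apply: (word_of_inj (c := c)).
  by rewrite x0 word_of_root.
rewrite walk_avgS /lazy_avg IH.
under eq_bigr => i _ do rewrite IH word_of_act.
by rewrite sum_letter /=; case: (word_of c x).
Qed.

End RadialKernel.

(** * Induced subgraphs *)

Section InducedSubgraph.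
Variables (V : Type) (e : rel V) (A : V -> Prop) (a0 : {x | A x}).

Definition induced : rel {x | A x} := fun x y => e (sval x) (sval y).

(** Vertices outside A are sent to the default a0; only vertices of A are lifted. *)
Definition lift_sub x : {x | A x} := if pselect (A x) is left Ax then exist A x Ax else a0.

Lemma sval_lift_sub x : A x -> sval (lift_sub x) = x.
Proof. by rewrite /lift_sub; case: pselect. Qed.

Lemma sval_sub_inj : injective (@sval V A).
Proof. by move=> [x Ax] [y Ay] /= xy; exact: eq_exist. Qed.

Lemma path_induced a (p : seq {x | A x}) :
  path e (sval a) (map sval p) = path induced a p.
Proof. by rewrite path_map. Qed.

Lemma walk_within_sval k a b :
  walk_within induced k a b -> walk_within e k (sval a) (sval b).
Proof.
move=> [p [pp <- sp]]; exists (map sval p).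
by rewrite path_induced last_map size_map.
Qed.

Lemma path_lift a p : path e (sval a) p -> (forall z, z \in (p : seq {classic V}) -> A z) ->
  path induced a (map lift_sub p) /\ sval (last a (map lift_sub p)) = last (sval a) p.
Proof.
elim: p a => [//|z p IH] a /= /andP[az zp] pA.
have sz : sval (lift_sub z) = z by apply: sval_lift_sub; apply: pA; rewrite inE eqxx.
have [||h1 h2] := IH (lift_sub z); rewrite ?sz//.
  by move=> y yp; apply: pA; rewrite inE yp orbT.
by split; rewrite ?h2 ?sz// {1}/induced sz az.
Qed.

Lemma walk_within_lift k a y :
  (forall p q, path e (sval a) (p ++ q) -> (size (p ++ q) <= k)%N -> A (last (sval a) p)) ->
  walk_within e k (sval a) y -> walk_within induced k a (lift_sub y).
Proof.
move=> pA [p [pp <- sp]]; exists (map lift_sub p).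
have pA' (z : {classic V}) : z \in (p : seq {classic V}) -> A z.
  move=> zp; have [p1 [p2 e12]] : exists p1 p2, p = rcons p1 z ++ p2.
    by case/path.splitP: zp => p1 p2; exists p1, p2.
  by have := pA (rcons p1 z) p2; rewrite -e12 last_rcons; exact.
have [pl ll] := path_lift pp pA'.
rewrite size_map; split=> //; apply: sval_sub_inj; rewrite ll sval_lift_sub//.
by have := pA p [::]; rewrite cats0; exact.
Qed.

End InducedSubgraph.

(** * A root-independent observable of rooted graphs *)

Definition relabel (T1 T2 : Type) (f : T1 -> T2) (s : seq ({classic T1} * nat)) :
  seq ({classic T2} * nat) := [seq (f q.1 : {classic T2}, q.2) | q <- s].

Lemma mem_relabel (T1 T2 : Type) (f : T1 -> T2) s p : p \in relabel f s ->
  exists2 q, q \in s & p = (f q.1, q.2).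
Proof. exact: (@mapP ({classic T1} * nat)%type ({classic T2} * nat)%type). Qed.

Lemma relabel_fst (T1 T2 : Type) (f : T1 -> T2) s :
  map fst (relabel f s) = map (f : {classic T1} -> {classic T2}) (map fst s).
Proof. by rewrite /relabel -!map_comp. Qed.

Section SlowGrowth.
Variables (R : realType) (d : nat).
Hypothesis d_gt0 : (0 < d)%N.
Implicit Types (G H : rooted_graph) (n : nat) (x r : R).

Definition distance_labelling n G (s : seq ({classic vertex G} * nat)) :=
  uniq (map fst s) /\
  forall p, p \in s -> (p.2 <= n)%N /\ walk_within (@Defs.edge G) p.2 (Defs.root G) p.1.

(** For a cluster of the tree, the supremum of these sums is the return
    probability at time n; the graph being arbitrary, finite families of vertices
    replace the sum over all vertices, and walks from the root replace distances. *)
Definition return_sum_le n G x := forall s : seq ({classic vertex G} * nat),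
  distance_labelling n s -> \sum_(p <- s) radial R d n p.2 <= x.

(** The constant C absorbs the change of root. *)
Definition slow_return r : set rooted_graph :=
  [set G | exists C : nat, forall n, return_sum_le n G (C%:R * r ^+ n)].

(** A fixed walk of length m from the old root to the new one changes times and
    distances by m, hence the kernel by a factor (2 d)^m. *)
Lemma slow_return_reroot r G (v : vertex G) : 0 <= r ->
  cluster (@Defs.edge G) (Defs.root G) v -> slow_return r G -> slow_return r (reroot v).
Proof.
move=> r0 [m [p [pp pl pm]]] [C HC].
pose M := (2 * d)%:R ^+ m * r ^+ m * C%:R : R.
have M0 : 0 <= M by rewrite !mulr_ge0 ?exprn_ge0.
exists (Num.bound M) => n s [us sw].
pose s' := [seq (q.1, (m + q.2)%N) | q <- s].
have lab' : distance_labelling (m + n) (s' : seq ({classic vertex G} * nat)).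
  split=> [|_ /mapP[q qs ->]]; first by rewrite -map_comp.
  have [qn [p' [pp' pl' pm']]] := sw _ qs; split; first by rewrite /= leq_add2l.
  exists (p ++ p'); rewrite cat_path last_cat pp pl size_cat; split=> //.
  exact: leq_add.
apply: le_trans (_ : (2 * d)%:R ^+ m * \sum_(q <- s') radial R d (m + n) q.2 <= _).
  rewrite big_map mulr_sumr; apply: ler_sum => q _; exact: radial_shift.
apply: le_trans (_ : M * r ^+ n <= _).
  rewrite /M -!mulrA ler_wpM2l ?exprn_ge0//.
  by apply: le_trans (HC _ _ lab') _; rewrite exprD mulrCA.
by rewrite ler_wpM2r ?exprn_ge0// ltW// archi_boundP.
Qed.

Lemma slow_return_root_independent r G (v : vertex G) : 0 <= r ->
  connected_rooted_graphs d G -> slow_return r (reroot v) <-> slow_return r G.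
Proof.
move=> r0 [_ _ conG _]; split; last exact/slow_return_reroot/conG.
case: G v conG => V e o v conG; exact: (@slow_return_reroot r (RootedGraph e v) o).
Qed.

Lemma return_sum_le_iso n G H x : rooted_iso G H ->
  return_sum_le n G x -> return_sum_le n H x.
Proof.
move=> [f [[g gK fK] fe fr]] HG s [us sw].
have := HG (relabel g s); rewrite big_map; apply; split.
  by rewrite relabel_fst map_inj_uniq//; exact: can_inj fK.
move=> _ /mem_relabel[q qs ->]; have [qn [p [pp pl ps]]] := sw _ qs; split=> //.
have gr : g (Defs.root H) = Defs.root G by rewrite -fr gK.
exists (map g p); rewrite -gr size_map last_map pl path_map; split=> //.
by rewrite -(eq_path (e := @Defs.edge H))// => a b; rewrite /= -fe !fK.
Qed.

Lemma rooted_iso_sym G H : rooted_iso G H -> rooted_iso H G.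
Proof.
move=> [f [[g gK fK] fe fr]]; exists g; split; first by exists f.
  by move=> a b; rewrite -fe !fK.
by rewrite -fr gK.
Qed.

Lemma rooted_iso_trans G H K : rooted_iso G H -> rooted_iso H K -> rooted_iso G K.
Proof.
move=> [f [fb fe fr]] [g [gb ge gr]]; exists (g \o f); split.
- exact: bij_comp.
- by move=> a b; rewrite /= ge fe.
- by rewrite /= fr gr.
Qed.

Lemma slow_return_iso r G H : rooted_iso G H -> slow_return r G <-> slow_return r H.
Proof.
move=> GH; split=> -[C HC]; exists C => n; apply: return_sum_le_iso (HC n) => //.
exact: rooted_iso_sym.
Qed.

(** Labels at most n only see walks inside the ball. *)
Lemma return_sum_le_root_ball n G x :
  return_sum_le n (root_ball n G) x <-> return_sum_le n G x.
Proof.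
pose A := walk_within (@Defs.edge G) n (Defs.root G).
pose a0 := Defs.root (root_ball n G); pose L := @lift_sub _ A a0.
split=> HG s [us sw].
  have sA q : q \in s -> A q.1.
    by move=> /sw[qn [p [? ? ps]]]; exists p; split=> //; exact: leq_trans qn.
  have := HG (relabel L s); rewrite big_map; apply; split.
    rewrite relabel_fst.
    have tA (y : {classic vertex G}) : y \in map fst s -> A y.
      by move=> /(@mapP ({classic vertex G} * nat)%type)[q qs ->]; exact: sA.
    move: us tA; move: (map fst s) => t ut tA.
    apply: (@map_uniq {classic {y | A y}} {classic vertex G} sval).
    suff -> : map sval (map L t) = t by [].
    rewrite -[RHS]map_id -map_comp; apply/(@eq_in_map {classic vertex G}) => y yt.
    exact/sval_lift_sub/tA.
  move=> _ /mem_relabel[q qs ->]; have [qn qw] := sw _ qs; split=> //.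
  apply: (@walk_within_lift _ _ A a0 q.2 a0) => // p1 p2 p12 s12.
  exists p1; split=> //; first by move: p12; rewrite cat_path => /andP[].
  by apply: leq_trans qn; apply: leq_trans s12; rewrite size_cat leq_addr.
have := HG (relabel sval s); rewrite big_map; apply; split.
  by rewrite relabel_fst map_inj_uniq//; exact: sval_sub_inj.
move=> _ /mem_relabel[q qs ->]; have [qn qw] := sw _ qs; split=> //.
exact: (walk_within_sval qw).
Qed.

Lemma finite_root_ball n G : degree_at_most d (@Defs.edge G) ->
  finite_set [set y | walk_within (@Defs.edge G) n (Defs.root G) y].
Proof.
move=> degG; elim: n => [|n IH].
  apply: (@sub_finite_set _ _ [set Defs.root G]) => // y [p [_ <-]].
  by rewrite leqn0 => /nilP ->.
apply: (@sub_finite_set _ _ ([set Defs.root G] `|`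
  \bigcup_(z in [set y | walk_within (@Defs.edge G) n (Defs.root G) y])
     [set y | Defs.edge z y])).
  move=> y [p [+ <-]]; elim/last_ind: p => [_ _|p z _]; first by left.
  rewrite rcons_path last_rcons size_rcons ltnS => /andP[pp pz] pn.
  by right; exists (last (Defs.root G) p) => //; exists p.
rewrite finite_setU; split=> //; apply: bigcup_finite => // z _.
exact: card_le_finite (degG z) (finite_II d).
Qed.

Let code := (nat * nat * seq (nat * nat))%type.

(** Every finite rooted graph is isomorphic to one of these. The codes are
    countable, and vertices are natural numbers because vertex types live in Set. *)
Definition coded_graph (k : code) : rooted_graph :=
  @RootedGraph {i : nat | (i <= k.1.1)%N} (fun i j => (sval i, sval j) \in k.2)
    (exist _ (minn k.1.2 k.1.1) (geq_minr _ _)).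

Lemma root_ball_coded n G : degree_at_most d (@Defs.edge G) ->
  exists k, rooted_iso (root_ball n G) (coded_graph k).
Proof.
move=> degG; pose A := walk_within (@Defs.edge G) n (Defs.root G).
have /(@finite_seqP {classic vertex G})[s0 s0A] := finite_root_ball n degG.
pose s := undup s0.
have sP y : y \in s <-> A y.
  by rewrite mem_undup; have /= -> : A y = (y \in s0) by rewrite -[A y]/([set y | A y] y) s0A.
have us : uniq s by exact: undup_uniq.
have rs : Defs.root G \in s by apply/sP; exact: walk_within_refl.
pose N := (size s).-1.
have sN : size s = N.+1 by rewrite /N prednK//; case: (s) rs.
pose pos (y : vertex (root_ball n G)) := index (sval y : {classic vertex G}) s.
have posN y : (pos y <= N)%N.
  by rewrite -ltnS -sN index_mem; apply/sP; exact: (svalP y).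
pose at_pos (i : nat) : vertex (root_ball n G) :=
  lift_sub (Defs.root (root_ball n G)) (nth (Defs.root G : {classic vertex G}) s i).
have at_posE i : (i <= N)%N -> sval (at_pos i) = nth (Defs.root G : {classic vertex G}) s i.
  by move=> iN; apply: sval_lift_sub; apply/sP; rewrite mem_nth// sN.
have posK : cancel pos at_pos.
  move=> y; apply: sval_sub_inj; rewrite at_posE// nth_index//; apply/sP; exact: (svalP y).
have at_posK i : (i <= N)%N -> pos (at_pos i) = i.
  by move=> iN; rewrite /pos at_posE// index_uniq// sN.
pose es := [seq p <- [seq (i, j) | i <- iota 0 N.+1, j <- iota 0 N.+1] |
  Defs.edge (at_pos p.1) (at_pos p.2)].
exists (N, pos (Defs.root (root_ball n G)), es).
exists (fun y => exist _ (pos y) (posN y)); split.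
- exists (fun i => at_pos (sval i)); first exact: posK.
  by move=> [i iN]; apply: eq_exist; exact: at_posK.
- move=> x y; rewrite /= mem_filter !posK.
  suff -> : (pos x, pos y) \in [seq (i, j) | i <- iota 0 N.+1, j <- iota 0 N.+1].
    by rewrite andbT.
  apply/allpairsP; exists (pos x, pos y).
  by split=> //; rewrite mem_iota add0n ltnS posN.
- by apply: eq_exist => /=; apply/esym/minn_idPl.
Qed.

Local Notation local_sets := <<s connected_rooted_graphs d, local_cylinder d >>.

(** Balls have finitely many vertices, so up to isomorphism there are countably
    many of them, and S is a countable union of cylinders. *)
Lemma local_set_measurable n (S : set rooted_graph) :
  (forall G H, connected_rooted_graphs d G -> connected_rooted_graphs d H ->
     rooted_iso (root_ball n G) (root_ball n H) -> S G -> S H) ->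
  local_sets (connected_rooted_graphs d `&` S).
Proof.
move=> Siso.
pose cyl (k : code) := if `[< exists G, [/\ connected_rooted_graphs d G, S G &
    rooted_iso (root_ball n G) (coded_graph k)] >]
  then connected_rooted_graphs d `&` [set G | rooted_iso (root_ball n G) (coded_graph k)]
  else set0.
have -> : connected_rooted_graphs d `&` S =
    \bigcup_i (if unpickle i is Some k then cyl k else set0).
  apply/seteqP; split=> [G [DG SG]|G [i _]].
    have [_ _ _ degG] := DG; have [k Gk] := root_ball_coded n degG.
    exists (pickle k) => //; rewrite pickleK /cyl; case: asboolP => // -[].
    by exists G.
  case: unpickle => // k; rewrite /cyl; case: asboolP => // -[H [DH SH Hk]] [DG Gk].
  split=> //; apply: (Siso H G) => //.
  exact: rooted_iso_trans Hk (rooted_iso_sym Gk).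
apply: sigma_algebra_bigcup => i; case: unpickle => [k|]; last exact: sigma_algebra0.
rewrite /cyl; case: asboolP => _; last exact: sigma_algebra0.
by apply: sub_sigma_algebra; exists n, (coded_graph k).
Qed.

Lemma measurable_slow_return r :
  local_sets (connected_rooted_graphs d `&` slow_return r).
Proof.
pose D := connected_rooted_graphs d.
pose S C n := D `&` [set G | return_sum_le n G (C%:R * r ^+ n)].
have mS C n : local_sets (S C n).
  apply: (@local_set_measurable n) => G H _ _ GH /= /return_sum_le_root_ball HG.
  by apply/return_sum_le_root_ball; exact: return_sum_le_iso HG.
have -> : D `&` slow_return r = \bigcup_C (D `\` \bigcup_n (D `\` S C n)).
  apply/seteqP; split=> [G [DG [C HC]]|G [C _ [DG HC]]].
    by exists C => //; split=> // -[n _ [_]]; apply; split=> //; exact: HC.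
  split=> //; exists C => n; apply: contrapT => H; apply: HC.
  by exists n => //; split=> // -[_].
apply: sigma_algebra_bigcup => C; apply: sigma_algebraCD.
by apply: sigma_algebra_bigcup => n; apply: sigma_algebraCD; exact: mS.
Qed.

Definition slow_indicator r G : R := `[< slow_return r G >]%:R.

Lemma measurable_slow_indicator r : measurable_graph_function d (slow_indicator r).
Proof.
split=> [G H _ _ GH|B _].
  by rewrite /slow_indicator (asbool_equiv_eq (slow_return_iso r GH)).
pose D := connected_rooted_graphs d.
have mD : local_sets D by rewrite -[D]setD0; apply: sigma_algebraCD; exact: sigma_algebra0.
have m1 := measurable_slow_return r.
have m0 := sigma_algebraCD m1; rewrite setDIr setDv set0U in m0.
have [B1|B1] := pselect (B 1); have [B0|B0] := pselect (B 0).
- suff -> : D `&` slow_indicator r @^-1` B = D by [].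
  by apply/seteqP; split=> [G []//|G DG]; split=> //=; rewrite /slow_indicator; case: asboolP.
- suff -> : D `&` slow_indicator r @^-1` B = D `&` slow_return r by [].
  by apply/seteqP; split=> G [DG] /=; rewrite /slow_indicator; case: asboolP.
- suff -> : D `&` slow_indicator r @^-1` B = D `\` slow_return r by [].
  by apply/seteqP; split=> G [DG] /=; rewrite /slow_indicator; case: asboolP.
- suff -> : D `&` slow_indicator r @^-1` B = set0 by exact: sigma_algebra0.
  by apply/seteqP; split=> G // [DG] /=; rewrite /slow_indicator; case: asboolP.
Qed.

Lemma root_independent_slow_indicator r : 0 <= r ->
  root_independent d (slow_indicator r).
Proof.
move=> r0 G DG v.
by rewrite /slow_indicator (asbool_equiv_eq (slow_return_root_independent v r0 DG)).
Qed.

End SlowGrowth.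

(** * Constancy of the rate for indistinguishable clusters *)

Section ClusterGraph.
Variables (R : realType) (d : nat) (V : Set) (adj : rel V) (o : V).
Variable c : tree_coding d adj o.
Hypothesis d_gt0 : (0 < d)%N.
Variable eta : rel V.
Hypotheses (eta_sym : symmetric eta) (eta_adj : subrel eta adj).

Lemma size_word_le_walk k y : walk_within eta k o y -> (size (word_of c y) <= k)%N.
Proof.
move=> [p [+ <- pk]]; move=> pp; apply: leq_trans pk.
elim/last_ind: p pp => [|p z IH]; first by rewrite word_of_root.
rewrite rcons_path last_rcons size_rcons => /andP[/IH pk /eta_adj].
move/(adj_word_of c) => [i ->]; exact: leq_trans (size_letter_le _ _) _.
Qed.

(** All edges of the geodesic from o to the vertex of w are open. *)
Fixpoint open_word (w : seq 'I_d) : Prop :=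
  if w is i :: w' then open_word w' /\ eta (vertex_of c w') (vertex_of c w) else True.

(** Each step of a walk along open edges lengthens the geodesic by an open edge or
    removes its last one. *)
Lemma cluster_open_word y : cluster eta o y -> open_word (word_of c y).
Proof.
move=> /clusterP[p [+ <-]]; elim/last_ind: p => [_|p z IH]; first by rewrite word_of_root.
rewrite rcons_path last_rcons => /andP[/IH ow ez].
have /(adj_word_of c)[i zi] := eta_adj ez.
have rw := reduced_word_of c (last o p).
rewrite -(word_ofK c z) -(word_ofK c (last o p)) zi in ez; rewrite zi.
move: ow rw ez; case: (word_of c (last o p)) => [//|j w] ow rw.
by rewrite /letter; case: eqVneq => [_ _|//]; case: ow.
Qed.

Lemma geodesic_in_cluster y : cluster eta o y ->
  walk_within eta (size (word_of c y)) o y.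
Proof.
move=> /cluster_open_word; rewrite -{3}(word_ofK c y).
elim: (word_of c y) => [_|i w IH /= [/IH[p [pp pl ps]] e]].
  by exists [::]; rewrite /= -(word_of_root c) word_ofK.
exists (rcons p (vertex_of c (i :: w))).
by rewrite rcons_path last_rcons size_rcons pp pl e.
Qed.

Let A y := cluster eta o y.
Let a0 : {y | A y} := exist _ o (cluster_refl eta o).

Lemma sum_dirac_mem (s : seq {classic V}) z : uniq s ->
  \sum_(y <- s) dirac_fun R y z = (z \in s)%:R.
Proof.
move=> us; elim: s us => [|y s IH] /=; first by rewrite big_nil.
case/andP=> ys us; rewrite big_cons IH// inE /dirac_fun.
case: asboolP => [e|ne].
  by rewrite -e eqxx (negbTE ys) addr0.
by rewrite add0r; case: eqVneq => // e; case: ne.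
Qed.

Lemma return_prob_radial_sum n (s : seq {classic V}) : uniq s ->
  \sum_(y <- s) radial R d n (size (word_of c y)) =
  walk_avg c n (fun z => (z \in s)%:R : R) o.
Proof.
move=> us; under eq_bigr => y _ do rewrite -(walk_avg_radial _ c) walk_avg_dirac_sym.
rewrite -walk_avg_sum; congr walk_avg; apply/funext => z.
exact: sum_dirac_mem.
Qed.

(** Distances within the cluster and in the tree agree, so the radial kernel
    computes the transition probabilities of the walk inside the cluster. *)
Lemma return_sum_le_cluster n x :
  return_sum_le d n (cluster_graph eta o) x <-> return_prob R c n eta o <= x.
Proof.
have connE y : conn eta o y = `[< A y >].
  by apply/idP/asboolP => /conn_symmetric; exact.
rewrite return_probE; split=> [Hx|ax s [us sw]].
  have [L Ln] := word_ball_finite d n.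
  pose t : seq {classic V} := [seq y <- undup ([seq vertex_of c w | w <- L] : seq {classic V}) | `[< A y >]].
  have ut : uniq t by rewrite filter_uniq ?undup_uniq.
  have tn y : y \in t -> A y by rewrite mem_filter => /andP[/asboolP].
  pose t' : seq {classic V} := [seq y <- t | (size (word_of c y) <= n)%N].
  have ut' : uniq t' by rewrite filter_uniq.
  have t'A y : y \in t' -> A y by rewrite mem_filter => /andP[_ /tn].
  have lab : @distance_labelling n (cluster_graph eta o)
      [seq ((lift_sub a0 y : {classic {y | A y}}), size (word_of c y)) | y <- t'].
    split.
      rewrite -map_comp; apply: (@map_uniq {classic {y | A y}} {classic V} sval).
      rewrite -map_comp (_ : map _ _ = t')// -[RHS]map_id.
      by apply/(@eq_in_map {classic V}) => y yt; exact/sval_lift_sub/t'A.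
    move=> _ /(@mapP {classic V} ({classic {y | A y}} * nat)%type)[y yt ->].
    split; first by move: yt; rewrite mem_filter => /andP[].
    apply: (@walk_within_lift _ _ A a0 _ a0) => [p q|].
      rewrite cat_path => /andP[pp _] _; apply/clusterP; by exists p.
    exact/geodesic_in_cluster/t'A.
  have := Hx _ lab; rewrite big_map return_prob_radial_sum//; apply: le_trans.
  rewrite le_eqVlt; apply/orP; left; apply/eqP; apply: eq_walk_avg_ball => y.
  rewrite word_of_root add0n => yn; rewrite connE.
  suff -> : `[< A y >] = ((y : {classic V}) \in t') by [].
  rewrite [RHS](@mem_filter {classic V}) yn [RHS](@mem_filter {classic V}).
  rewrite (@mem_undup {classic V}); case: asboolP => //= _.
  by apply/esym/(@mapP _ {classic V}); exists (word_of c y); rewrite ?Ln// word_ofK.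
apply: le_trans ax.
pose t := map (@sval V A : {classic _} -> {classic V}) (map fst s).
have ut : uniq t by rewrite map_inj_uniq//; exact: sval_sub_inj.
apply: le_trans (_ : \sum_(y <- t) radial R d n (size (word_of c y)) <= _).
  rewrite /t !big_map big_seq [leRHS]big_seq; apply: ler_sum => p ps.
  apply: radial_nonincreasing => //; apply: size_word_le_walk.
  have [_ pw] := sw _ ps; exact: (walk_within_sval pw).
rewrite return_prob_radial_sum//; apply: le_walk_avg => y.
rewrite connE ler_nat; case: asboolP => [_|nA]; first exact: leq_b1.
rewrite leqn0 eqb0; apply/negP => /(@mapP {classic _} {classic V})[z _ yz].
by apply: nA; rewrite yz; exact: (svalP z).
Qed.

Lemma slow_return_cluster r : slow_return d r (cluster_graph eta o) <->
  exists C : nat, forall n, return_prob R c n eta o <= C%:R * r ^+ n.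
Proof.
by split=> -[C HC]; exists C => n; apply/return_sum_le_cluster.
Qed.

Lemma lt_rate_slow q l : 0 <= q -> (fun n => decay_rate R c n eta) @ \oo --> l -> q < l ->
  slow_return d (expR (- q)) (cluster_graph eta o).
Proof.
move=> q0 cl ql; apply/slow_return_cluster.
have lq : 0 < l - q by rewrite subr_gt0.
move/cvgrPdist_le : cl => /(_ _ lq)[N _ HN].
exists (Num.bound (expR (N%:R * q))).+1 => n.
rewrite -expRM_natl; have [nN|Nn] := leqP n N.
  apply: le_trans (field_le1 eta o (field_return_prob R c d_gt0 n)) _.
  apply: le_trans (_ : expR (N%:R * q) * expR (n%:R * - q) <= _).
    by rewrite -expRD -[leLHS]expR0 ler_expR mulrN subr_ge0 ler_wpM2r// ler_nat.
  rewrite ler_wpM2r ?expR_ge0// (le_trans (ltW (archi_boundP (expR_ge0 _))))//.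
  by rewrite ler_nat.
have n0 : (0 < n)%N by exact: leq_ltn_trans Nn.
have := HN n (ltnW Nn); rewrite ler_norml => /andP[_ H].
rewrite (return_prob_decay R c eta n0) -[leLHS]mul1r ler_pM// ?expR_ge0// ?ler1n//.
by rewrite ler_expR mulrN lerN2 ler_wpM2l//; lra.
Qed.

Lemma slow_le_rate q l : (fun n => decay_rate R c n eta) @ \oo --> l ->
  slow_return d (expR (- q)) (cluster_graph eta o) -> q <= l.
Proof.
move=> cl /slow_return_cluster[C HC].
apply/ler_addgt0Pr => e e0; have e2 : 0 < e / 2 by rewrite divr_gt0.
have C0 : 0 < C%:R :> R.
  by have := HC 0%N; rewrite return_prob0 expr0 mulr1; exact: lt_le_trans.
have Cl : 0 <= ln (C%:R) :> R by rewrite ln_ge0// ler1n -(ltr0n R).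
move/cvgrPdist_le : cl => /(_ _ e2)[N _ HN].
pose n := (maxn N (Num.bound (ln (C%:R) / (e / 2)))).+1.
have nR : 0 < n%:R :> R by rewrite ltr0n.
have := HN n; rewrite /= ler_norml => /(_ (leqW (leq_maxl _ _)))/andP[H _].
have Cn : ln (C%:R) / n%:R <= e / 2 :> R.
  rewrite ler_pdivrMr// mulrC -ler_pdivrMr//.
  apply: le_trans (ltW (archi_boundP _)) _; first by rewrite divr_ge0// ltW.
  by rewrite ler_nat leqW// leq_maxr.
have : decay_rate R c n eta >= q - ln C%:R / n%:R.
  have := HC n; rewrite -expRM_natl -ler_ln ?posrE ?mulr_gt0 ?expR_gt0 ?return_prob_gt0//.
  rewrite lnM ?posrE ?expR_gt0// expRK => Hn.
  rewrite /decay_rate -[q](mulfK (lt0r_neq0 nR)) -mulrBl ler_pM2r ?invr_gt0//.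
  lra.
lra.
Qed.

End ClusterGraph.

(** Two configurations with different limits would be separated by the property
    [slow_return] for some rational threshold, but each of these countably many
    properties has the same truth value almost surely. *)
Lemma ae_constant_rate (R : realType) (d : nat) (V : Set) (adj : rel V) (o : V)
  (c : tree_coding d adj o) (d_gt0 : (0 < d)%N)
  (d0 : measure_display) (Omega : measurableType d0) (P : probability Omega R)
  (E : Omega -> rel V) : invariant_percolation P adj E ->
  indistinguishable_clusters P d o E ->
  exists l : R, {ae P, forall w, (fun n => decay_rate R c n (E w)) @ \oo --> l}.
Proof.
move=> invE ergE; have [Eadj _ _] := invE.
pose q n : R := ratr (odflt 0 (unpickle n : option rat)).
have /choice[b bP] : forall n, exists b,
    {ae P, forall w, slow_indicator d (expR (- q n)) (cluster_graph (E w) o) = b :> R}.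
  move=> n; apply: ergE; first exact: measurable_slow_indicator.
  by apply: root_independent_slow_indicator; rewrite ?expR_ge0.
have good : {ae P, forall w, cvgn (fun n => decay_rate R c n (E w)) /\
    forall n, slow_indicator d (expR (- q n)) (cluster_graph (E w) o) = b n :> R}.
  by apply: filterI; [exact: ae_cvg_decay_rate invE|exact: ae_foralln].
have [w0 [cw0 bw0]] : exists w, cvgn (fun n => decay_rate R c n (E w)) /\
    forall n, slow_indicator d (expR (- q n)) (cluster_graph (E w) o) = b n :> R.
  apply: contrapT => H; case: good => N [mN N0 sN].
  have NT : N = setT.
    by apply/seteqP; split=> // w _; apply: sN => /= Hw; apply: H; exists w.
  move: N0; rewrite NT => N0; have := probability_setT P.
  by rewrite N0 => -[] /eqP; rewrite eq_sym oner_eq0.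
exists (limn (fun n => decay_rate R c n (E w0))).
apply: filterS good => w [cw bw].
suff <- : limn (fun n => decay_rate R c n (E w)) = limn (fun n => decay_rate R c n (E w0)) by [].
have rate_le u v : cvgn (fun n => decay_rate R c n (E u)) ->
    cvgn (fun n => decay_rate R c n (E v)) ->
    (forall n, slow_indicator d (expR (- q n)) (cluster_graph (E u) o) = b n :> R) ->
    (forall n, slow_indicator d (expR (- q n)) (cluster_graph (E v) o) = b n :> R) ->
    limn (fun n => decay_rate R c n (E u)) <= limn (fun n => decay_rate R c n (E v)).
  move=> cu cv bu bv; rewrite leNgt; apply/negP => /rat_in_itvoo[x].
  rewrite in_itv /= => /andP[vx xu].
  have [su au] := Eadj u; have [sv av] := Eadj v.
  have v0 : 0 <= limn (fun n => decay_rate R c n (E v)).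
    by apply: limr_ge => //; apply: nearW => n; exact: decay_rate_ge0.
  have x0 : 0 <= ratr x :> R by exact: ltW (le_lt_trans v0 vx).
  have qx : q (pickle x) = ratr x by rewrite /q pickleK.
  have := lt_rate_slow d_gt0 su au x0 cu xu.
  have := bu (pickle x); rewrite -(bv (pickle x)) qx /slow_indicator.
  case: asboolP => // _; case: asboolP => [sl _ _|_ /eqP]; last by rewrite oner_eq0.
  by have := slow_le_rate d_gt0 sv av cv sl; rewrite leNgt vx.
by apply/eqP; rewrite eq_le !rate_le.
Qed.

(** * Return roots *)

Section ReturnRoots.
Variables (R : realType) (d : nat) (V : Set) (adj : rel V) (o : V).
Variable c : tree_coding d adj o.
Hypotheses (d_gt0 : (0 < d)%N) (adj_irr : irreflexive adj).
Variables (d0 : measure_display) (Omega : measurableType d0).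
Variables (P : probability Omega R) (E : Omega -> rel V).
Hypothesis invE : invariant_percolation P adj E.
Variables (d1 : measure_display) (Omega' : measurableType d1).
Variables (Q : probability Omega' R) (X : nat -> Omega' -> V).
Hypothesis walkX : lazy_random_walk Q d adj o X.

Lemma walk_in_cluster n w :
  Q [set w' | cluster (E w) o (X n w')] = (return_prob R c n (E w) o)%:E.
Proof.
rewrite (walk_law c d_gt0 adj_irr walkX) return_probE; congr (walk_avg c n _ o)%:E.
apply/funext => y; congr (_%:R); congr nat_of_bool.
have [Eadj _ _] := invE; have [Esym _] := Eadj w.
by apply/asboolP/idP => /conn_symmetric; exact.
Qed.

Lemma quenched_returnE n w :
  quenched_return Q o E X n w = return_prob R c n (E w) o.
Proof. by rewrite /quenched_return walk_in_cluster. Qed.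

Lemma measurable_walk_in_cluster n :
  measurable [set z : Omega * Omega' | cluster (E z.1) o (X n z.2)].
Proof.
have -> : [set z : Omega * Omega' | cluster (E z.1) o (X n z.2)] =
    \bigcup_v ([set w | cluster (E w) o v] `*` [set w' | X n w' = v]).
  by apply/seteqP; split=> [[w w'] /= h|[w w'] [v _ [/= h /= ->]]//]; exists (X n w').
apply: countable_bigcupT_measurable; first exact: coding_countable c.
move=> v; apply: measurableX; last exact: walkX.1.
have mC := @measurable_cluster V o v (coding_countable c).
by have := measurable_config_map invE measurableT mC; rewrite setTI.
Qed.

Lemma annealed_returnE n :
  annealed_return P Q o E X n = expect P E (fun eta => return_prob R c n eta o).
Proof.
rewrite /annealed_return /expect /Rintegral; congr fine.
have mA := measurable_walk_in_cluster n.
rewrite unlock integral_indic// setIT.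
apply: eq_integral => w _ /=.
rewrite -walk_in_cluster; congr (Q _); apply/seteqP; split=> w' /=.
  by rewrite /xsection /= inE.
by move=> h; rewrite /xsection /= inE.
Qed.

Lemma quenched_rootE n w :
  quenched_return Q o E X n w `^ n%:R^-1 = expR (- decay_rate R c n (E w)).
Proof.
rewrite quenched_returnE /powR gt_eqF ?return_prob_gt0//.
by rewrite /decay_rate mulNr opprK mulrC.
Qed.

Lemma annealed_rootE n :
  annealed_return P Q o E X n `^ n%:R^-1 = expR (- annealed_rate c P E n).
Proof.
rewrite annealed_returnE /powR gt_eqF ?expect_return_gt0//.
by rewrite /annealed_rate mulNr opprK mulrC.
Qed.

Lemma cvg_expR_even (u : nat -> R) l : u @ \oo --> l ->
  (fun n => expR (- u (2 * n)%N)) @ \oo --> expR (- l).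
Proof.
move=> ul; apply: (@continuous_cvg _ _ _ _ _ _ expR); first exact: continuous_expR.
apply: cvgN; apply: cvg_comp ul.
move=> S [N _ HN]; exists N => // n /= Nn; apply: HN => /=.
by rewrite (leq_trans Nn)// leq_pmull.
Qed.

End ReturnRoots.

Theorem theorem3p1 (R : realType) (d : nat) (d_gt0 : (0 < d)%N)
  (V : Set) (adj : rel V) (treeV : regular_tree d adj) (o : V)
  (d0 : measure_display) (Omega : measurableType d0) (P : probability Omega R)
  (E : Omega -> rel V) (invE : invariant_percolation P adj E)
  (d1 : measure_display) (Omega' : measurableType d1)
  (Q : probability Omega' R) (X : nat -> Omega' -> V)
  (walkX : lazy_random_walk Q d adj o X) :
  let quenched_root w := fun n : nat =>
    quenched_return Q o E X (2 * n)%N w `^ (2 * n)%N%:R^-1 in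
  let annealed_root := fun n : nat =>
    annealed_return P Q o E X (2 * n)%N `^ (2 * n)%N%:R^-1 in
  {ae P, forall w, cvgn (quenched_root w)} /\
  (indistinguishable_clusters P d o E ->
     cvgn annealed_root /\
     {ae P, forall w, limn (quenched_root w) = limn annealed_root}).
Proof.
move=> quenched_root annealed_root.
have c := unsquash (tree_coding_exists o treeV).
have [_ adj_irr _ _ _] := treeV.
have qE w : quenched_root w = (fun n => expR (- decay_rate R c (2 * n) (E w))).
  by apply/funext => n; rewrite /quenched_root (quenched_rootE c d_gt0 adj_irr invE walkX).
have aE : annealed_root = (fun n => expR (- annealed_rate c P E (2 * n))).
  by apply/funext => n; rewrite /annealed_root (annealed_rootE c d_gt0 adj_irr invE walkX).
split=> [|ergE].
  apply: filterS (ae_cvg_decay_rate c d_gt0 invE) => w cw.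
  have /cvg_ex[l /cvg_expR_even] := cw; rewrite -qE => ql.
  by apply/cvg_ex; exists (expR (- l)).
have [l lP] := ae_constant_rate c d_gt0 invE ergE.
have acvg : annealed_root @ \oo --> expR (- l).
  by rewrite aE; have /cvg_expR_even := cvg_annealed_rate d_gt0 invE lP; exact.
split; first by apply/cvg_ex; exists (expR (- l)).
apply: filterS lP => w /cvg_expR_even; rewrite -qE => qcvg.
by rewrite (cvg_lim (@Rhausdorff R) qcvg) (cvg_lim (@Rhausdorff R) acvg).
Qed.
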